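(* Let $k$ be an algebraically closed field, let $A$ be a finite-dimensional $k$-algebra, and let $\Gamma$ be a connected component of the Auslander-Reiten quiver of $A$. The following statements are equivalent: (a) $\Gamma$ is mesh-comparable. (b) For each arrow $\alpha:X\to Y$ of $\Gamma$ there exists an irreducible morphism $f_\alpha:X\to Y$ such that: (i) if $X$ is a projective module of $\Gamma$ and $\alpha_1:X_1\to X,\ldots,\alpha_r:X_r\to X$ are all the arrows of $\Gamma$ ending in $X$, then $[f_{\alpha_1}\ \cdots\ f_{\alpha_r}]:X_1\oplus\cdots\oplus X_r\to X$ is a right almost split morphism; (ii) if $X$ is an injective module of $\Gamma$ and $\alpha_1:X\to X_1,\ldots,\alpha_r:X\to X_r$ are all the arrows of $\Gamma$ starting at $X$, then $[f_{\alpha_1}\ \cdots\ f_{\alpha_r}]^T:X\to X_1\oplus\cdots\oplus X_r$ is a left almost split morphism; (iii) if $X$ is a non-projective module in $\Gamma$, and the mesh ending at $X$ consists of the arrows $\alpha_1:X_1\to X,\ldots,\alpha_r:X_r\to X$ (all the arrows of $\Gamma$ ending at $X$) together with the arrows $\sigma\alpha_1:\tau X\to X_1,\ldots,\sigma\alpha_r:\tau X\to X_r$, then $$0\to\tau X\xrightarrow{[f_{\sigma\alpha_1}\ \cdots\ f_{\sigma\alpha_r}]^T}X_1\oplus\cdots\oplus X_r\xrightarrow{[f_{\alpha_1}\ \cdots\ f_{\alpha_r}]}X\to 0$$ is an almost split sequence.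
   Context: Algebras are associative and unital; $\operatorname{mod} A$ is the category of finitely generated right $A$-modules. The radical $\operatorname{rad}_A$ is the ideal of $\operatorname{mod} A$ such that for $X,Y$ indecomposable $\operatorname{rad}_A(X,Y)$ is the set of non-isomorphisms $X\to Y$, extended to direct sums componentwise. A morphism $X\to Y$ between indecomposables is irreducible iff it lies in $\operatorname{rad}(X,Y)\setminus\operatorname{rad}^2(X,Y)$. A morphism $f:X\to Y$ is left almost split if it is radical, $X$ is indecomposable, and every radical morphism $u:X\to U$ factors as $u=u'f$; it is left minimal if every $h:Y\to Y$ with $hf=f$ is invertible; right almost split and right minimal are dual. An almost split sequence is a short exact sequence $0\to L\to M\to N\to 0$ both of whose nonzero maps are irreducible. The Auslander-Reiten quiver of $A$ has as vertices the isomorphism classes of indecomposable $A$-modules, and $\dim_k \operatorname{rad}(M,N)/\operatorname{rad}^2(M,N)$ arrows from $M$ to $N$. A connected component $\Gamma$ is a translation quiver with the Auslander-Reiten translation $\tau$: for every non-projective vertex $x$ and every vertex $y$ a bijection $\alpha\mapsto\sigma(\alpha)=\sigma\alpha$ from arrows $y\to x$ to arrows $\tau x\to y$ is fixed. Vertices of $\Gamma$ are identified with (fixed representatives of) indecomposable modules; $\operatorname{ind}\Gamma$ is the full subcategory of $\operatorname{mod} A$ given by the indecomposable modules in $\Gamma$. The path category $k\Gamma$ has the vertices of $\Gamma$ as objects, and as morphisms $x\to y$ the formal $k$-linear combinations of paths from $x$ to $y$. The mesh category $k(\Gamma)$ is the quotient of $k\Gamma$ by the ideal generated by the mesh relations $\sum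 \alpha\,\sigma(\alpha):\tau x\to x$, where $x$ is non-projective and the sum runs over all arrows $\alpha$ ending at $x$; $\overline{\alpha}$ is the class of an arrow $\alpha$. A Riedtmann functor is a $k$-linear functor $F:k(\Gamma)\to\operatorname{ind}\Gamma$ such that for every vertex $X$: (1) $FX=X$; (2) if $\alpha_i:X\to X_i$, $1\le i\le r$, are all the arrows starting at $X$, then $[F(\overline{\alpha_1})\ \cdots\ F(\overline{\alpha_r})]^t:X\to X_1\oplus\cdots\oplus X_r$ is left minimal almost split; (3) if $\alpha_i:X_i\to X$, $1\le i\le r$, are all the arrows ending at $X$, then $[F(\overline{\alpha_1})\ \cdots\ F(\overline{\alpha_r})]:X_1\oplus\cdots\oplus X_r\to X$ is right minimal almost split. $\Gamma$ is mesh-comparable if a Riedtmann functor $k(\Gamma)\to\operatorname{ind}\Gamma$ exists. *)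

(* Defs.v *)
From HB Require Import structures.
From Stdlib Require Export Relation_Operators.
From mathcomp Require Export all_boot all_algebra all_field.
From mathcomp Require Export generic_quotient ring_quotient.
From mathcomp Require Export boolp finmap monalg.

Set Implicit Arguments.
Unset Strict Implicit.
Unset Printing Implicit Defensive.

Import GRing.Theory.
Local Open Scope ring_scope.
Local Open Scope quotient_scope.

Definition finitely_generated (R : nzRingType) (M : lmodType R) : Prop :=
  exists (n : nat) (g : 'I_n -> M),
    forall x, exists a : 'I_n -> R, x = \sum_(i < n) a i *: g i.

(* A right A-module is a left module over the converse algebra A^c, so that
   the right action x.a is written a *: x. *)
Record fgmod (k : fieldType) (A : falgType k) : Type := FgMod {
  fgmod_car :> lmodType A^c;
  fgmod_fg : finitely_generated fgmod_car
}.

Definition homA (k : fieldType) (A : falgType k) (X Y : lmodType A^c) : Type :=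
  {linear X -> Y}.

HB.instance Definition _ (k : fieldType) (A : falgType k)
  (X Y : lmodType A^c) := gen_eqMixin (homA X Y).
HB.instance Definition _ (k : fieldType) (A : falgType k)
  (X Y : lmodType A^c) := gen_choiceMixin (homA X Y).

Section HomSpace.
Variables (k : fieldType) (A : falgType k).
Implicit Types X Y Z : lmodType A^c.

Definition mkhom X Y (f : X -> Y) (fL : linear f) : homA X Y :=
  HB.pack f (GRing.isLinear.Build A^c X Y *:%R f fL).

Lemma homA_ext X Y (f g : homA X Y) : f =1 g -> f = g.
Proof.
case: f g => [f [[hf0] [hf1]]] [g [[hg0] [hg1]]] /= /funext /= fg.
subst g; congr (GRing.Linear.Pack (GRing.Linear.Class _ _)).
- by rewrite (Prop_irrelevance hf0 hg0).
- by rewrite (Prop_irrelevance hf1 hg1).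
Qed.

Fact hid_linear X : linear (@idfun X). Proof. by []. Qed.
Definition hid X : homA X X := mkhom (@hid_linear X).

Fact hcomp_linear X Y Z (g : homA Y Z) (f : homA X Y) : linear (g \o f).
Proof. by move=> a x y /=; rewrite !linearP. Qed.
Definition hcomp X Y Z (g : homA Y Z) (f : homA X Y) : homA X Z :=
  mkhom (hcomp_linear g f).

Fact hzero_linear X Y : linear (fun _ : X => 0 : Y).
Proof. by move=> a x y /=; rewrite scaler0 addr0. Qed.
Definition hzero X Y : homA X Y := mkhom (@hzero_linear X Y).

Fact hadd_linear X Y (f g : homA X Y) : linear (fun x => f x + g x).
Proof. by move=> a x y; rewrite !linearP scalerDr addrACA. Qed.
Definition hadd X Y (f g : homA X Y) : homA X Y := mkhom (hadd_linear f g).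

Fact hopp_linear X Y (f : homA X Y) : linear (fun x => - f x).
Proof. by move=> a x y; rewrite linearP opprD scalerN. Qed.
Definition hopp X Y (f : homA X Y) : homA X Y := mkhom (hopp_linear f).

Fact hscale_linear X Y (c : k) (f : homA X Y) :
  linear (fun x => (c%:A : A^c) *: f x).
Proof.
move=> a x y; rewrite linearP scalerDr !scalerA; congr (_ *: _ + _).
have /= : @GRing.mul A a c%:A = @GRing.mul A c%:A a by rewrite mulr_algr mulr_algl.
exact.
Qed.
Definition hscale X Y (c : k) (f : homA X Y) : homA X Y :=
  mkhom (hscale_linear c f).

End HomSpace.

Section HomLmodule.
Variables (k : fieldType) (A : falgType k) (X Y : lmodType A^c).

Fact haddA : associative (@hadd k A X Y).
Proof. by move=> f g h; apply: homA_ext => x /=; rewrite addrA. Qed.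
Fact haddC : commutative (@hadd k A X Y).
Proof. by move=> f g; apply: homA_ext => x /=; rewrite addrC. Qed.
Fact hadd0 : left_id (@hzero k A X Y) (@hadd k A X Y).
Proof. by move=> f; apply: homA_ext => x /=; rewrite add0r. Qed.
Fact haddN : left_inverse (@hzero k A X Y) (@hopp k A X Y) (@hadd k A X Y).
Proof. by move=> f; apply: homA_ext => x /=; rewrite addNr. Qed.
HB.instance Definition _ :=
  GRing.isZmodule.Build (homA X Y) haddA haddC hadd0 haddN.

Fact hscaleA (c d : k) (f : homA X Y) :
  hscale c (hscale d f) = hscale (c * d) f.
Proof.
apply: homA_ext => x /=; rewrite scalerA; congr (_ *: _).
have /= : @GRing.mul A d%:A c%:A = (c * d)%:A by rewrite mulr_algr scalerA.
exact.
Qed.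
Fact hscale1 : left_id 1 (@hscale k A X Y).
Proof. by move=> f; apply: homA_ext => x /=; rewrite !scale1r. Qed.
Fact hscaleDr : right_distributive (@hscale k A X Y) +%R.
Proof. by move=> c f g; apply: homA_ext => x /=; rewrite scalerDr. Qed.
Fact hscaleDl (f : homA X Y) :
  {morph (fun c : k => hscale c f) : c d / c + d}.
Proof. by move=> c d; apply: homA_ext => x /=; rewrite !scalerDl. Qed.
HB.instance Definition _ :=
  GRing.Zmodule_isLmodule.Build k (homA X Y) hscaleA hscale1 hscaleDr hscaleDl.

End HomLmodule.

Definition dsum_car (R : nzRingType) (I : finType) (X : I -> lmodType R) : Type :=
  forall i, X i.

Section DirectSum.
Variables (R : nzRingType) (I : finType) (X : I -> lmodType R).

HB.instance Definition _ := gen_eqMixin (dsum_car X).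
HB.instance Definition _ := gen_choiceMixin (dsum_car X).

Implicit Types u v w : dsum_car X.
Let dadd u v : dsum_car X := fun i => u i + v i.
Let dopp u : dsum_car X := fun i => - u i.
Let dzero : dsum_car X := fun i => 0.
Let dscale (a : R) u : dsum_car X := fun i => a *: u i.

Fact daddA : associative dadd.
Proof. by move=> u v w; apply/functional_extensionality_dep => i; apply: addrA. Qed.
Fact daddC : commutative dadd.
Proof. by move=> u v; apply/functional_extensionality_dep => i; apply: addrC. Qed.
Fact dadd0 : left_id dzero dadd.
Proof. by move=> u; apply/functional_extensionality_dep => i; apply: add0r. Qed.
Fact daddN : left_inverse dzero dopp dadd.
Proof. by move=> u; apply/functional_extensionality_dep => i; apply: addNr. Qed.
HB.instance Definition _ :=
  GRing.isZmodule.Build (dsum_car X) daddA daddC dadd0 daddN.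

Fact dscaleA a b u : dscale a (dscale b u) = dscale (a * b) u.
Proof. by apply/functional_extensionality_dep => i; apply: scalerA. Qed.
Fact dscale1 : left_id 1 dscale.
Proof. by move=> u; apply/functional_extensionality_dep => i; apply: scale1r. Qed.
Fact dscaleDr : right_distributive dscale +%R.
Proof. by move=> a u v; apply/functional_extensionality_dep => i; apply: scalerDr. Qed.
Fact dscaleDl u : {morph dscale^~ u : a b / a + b}.
Proof. by move=> a b; apply/functional_extensionality_dep => i; apply: scalerDl. Qed.
HB.instance Definition _ :=
  GRing.Zmodule_isLmodule.Build R (dsum_car X) dscaleA dscale1 dscaleDr dscaleDl.

Lemma dsum_sumE (J : Type) (s : seq J) (P : pred J) (u : J -> dsum_car X) i :
  (\sum_(j <- s | P j) u j) i = \sum_(j <- s | P j) u j i.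
Proof. by apply: (big_morph (fun w : dsum_car X => w i)). Qed.

Definition dinj_fun (i : I) (x : X i) : dsum_car X :=
  dfwith (fun j => 0 : X j) x.

Fact dinj_linear i : linear (@dinj_fun i).
Proof.
move=> a x y; apply/functional_extensionality_dep => j.
change (dinj_fun (a *: x + y) j = a *: dinj_fun x j + dinj_fun y j).
rewrite /dinj_fun; have [->|ij] := eqVneq j i; first by rewrite !dfwith_in.
by rewrite !dfwith_out 1?eq_sym // scaler0 addr0.
Qed.

Lemma dsum_decomp (u : dsum_car X) : u = \sum_i dinj_fun (u i).
Proof.
apply/functional_extensionality_dep => j; rewrite dsum_sumE (bigD1 j) //=.
rewrite {1}/dinj_fun dfwith_in big1 ?addr0 // => i ij.
by rewrite /dinj_fun dfwith_out.
Qed.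

Lemma dsum_fg : (forall i, finitely_generated (X i)) ->
  finitely_generated (dsum_car X : lmodType R).
Proof.
move=> /fin_all_exists[n] /fin_all_exists[g fg].
pose T := {i : I & 'I_(n i)}.
exists #|{: T}|, (fun t => let s : T := enum_val t in dinj_fun (g _ (tagged s))).
move=> u; have /fin_all_exists[a ua] : forall i, exists a : 'I_(n i) -> R,
    u i = \sum_(j < n i) a j *: g i j by move=> i; apply: fg.
exists (fun t => let s : T := enum_val t in a _ (tagged s)).
pose F (s : T) := a _ (tagged s) *: (dinj_fun (g _ (tagged s)) : dsum_car X).
transitivity (\sum_(s : T) F s); last exact: (big_enum_val F).
rewrite [u in LHS]dsum_decomp.
rewrite -(@sig_big_dep _ _ _ I (fun i => 'I_(n i)) predT (fun _ => predT)
  (fun i j => a i j *: (dinj_fun (g i j) : dsum_car X))) /=.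
apply: eq_bigr => i _; rewrite ua.
pose L := GRing.isLinear.Build R (X i) (dsum_car X) *:%R _ (@dinj_linear i).
pose l : {linear X i -> dsum_car X} := HB.pack (@dinj_fun i) L.
by rewrite -[LHS]/(l _) linear_sum; apply: eq_bigr => j _; rewrite linearZ.
Qed.
End DirectSum.

Section ModuleNotions.
Variables (k : fieldType) (A : falgType k).
Implicit Types M N P T U X Y Z : fgmod A.

Definition dsum (I : finType) (X : I -> fgmod A) : fgmod A :=
  @FgMod k A (dsum_car X) (dsum_fg (fun i => fgmod_fg (X i))).

Section Matrices.
Variables (I : finType) (X : I -> fgmod A) (Y : fgmod A).

Definition dinj (i : I) : homA (X i) (dsum X) :=
  mkhom (@dinj_linear A^c I X i).

Fact dproj_linear (i : I) : linear (fun u : dsum X => u i).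
Proof. by []. Qed.
Definition dproj (i : I) : homA (dsum X) (X i) := mkhom (dproj_linear i).

Fact hcol_linear (f : forall i, homA Y (X i)) :
  linear (fun y => (fun i => f i y) : dsum X).
Proof.
by move=> a x y; apply/functional_extensionality_dep => i; apply: linearP.
Qed.
Definition hcol (f : forall i, homA Y (X i)) : homA Y (dsum X) :=
  mkhom (hcol_linear f).

Fact hrow_linear (f : forall i, homA (X i) Y) :
  linear (fun u : dsum X => \sum_i f i (u i)).
Proof.
move=> a u v; rewrite scaler_sumr -big_split; apply: eq_bigr => i _.
exact: linearP.
Qed.
Definition hrow (f : forall i, homA (X i) Y) : homA (dsum X) Y :=
  mkhom (hrow_linear f).

End Matrices.

Definition isomorphic X Y : Prop := exists f : homA X Y, bijective f.

Definition indecomposable X : Prop :=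
  (exists x : X, x != 0) /\
  forall U V : fgmod A,
    (exists f : {linear (U * V)%type -> X}, bijective f) ->
    (forall u : U, u = 0) \/ (forall v : V, v = 0).

Definition hsurjective X Y (f : homA X Y) : Prop := forall y, exists x, f x = y.

Definition projective_module P : Prop :=
  forall M N (g : homA M N) (f : homA P N), hsurjective g ->
    exists h : homA P M, f = hcomp g h.

Definition injective_module P : Prop :=
  forall M N (g : homA M N) (f : homA M P), injective g ->
    exists h : homA N P, f = hcomp h g.

Definition section_mor X Y (f : homA X Y) : Prop :=
  exists g : homA Y X, hcomp g f = hid X.

Definition retraction_mor X Y (f : homA X Y) : Prop :=
  exists g : homA Y X, hcomp f g = hid Y.

(* f is radical if, after decomposing X and Y into indecomposables, no entry
   of its matrix is an isomorphism. *)
Definition radical X Y (f : homA X Y) : Prop :=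
  exists (m n : nat) (U : 'I_m -> fgmod A) (V : 'I_n -> fgmod A)
         (p : homA (dsum U) X) (q : homA Y (dsum V)),
    [/\ forall i, indecomposable (U i), forall j, indecomposable (V j),
        bijective p, bijective q &
        forall i j,
          ~ bijective (hcomp (dproj V j) (hcomp q (hcomp f (hcomp p (dinj U i)))))].

Definition radical2 X Y (f : homA X Y) : Prop :=
  exists (n : nat) (Z : 'I_n -> fgmod A)
         (g : forall i, homA X (Z i)) (h : forall i, homA (Z i) Y),
    [/\ forall i, radical (g i), forall i, radical (h i) &
        f = \sum_(i < n) hcomp (h i) (g i)].

(* dim_k rad(X, Y) / rad^2(X, Y) = n: the classes of the b i form a basis. *)
Definition rad_quotient_dim X Y (n : nat) : Prop :=
  exists b : 'I_n -> homA X Y,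
    [/\ forall i, radical (b i),
        forall f, radical f ->
          exists c : 'I_n -> k, radical2 (f - \sum_(i < n) c i *: b i) &
        forall c : 'I_n -> k,
          radical2 (\sum_(i < n) c i *: b i) -> forall i, c i = 0].

(* Meant for X and Y indecomposable. *)
Definition irreducible_ind X Y (f : homA X Y) : Prop :=
  radical f /\ ~ radical2 f.

(* For arbitrary modules, since the middle term of an almost split sequence may
   be decomposable; between indecomposables this agrees with irreducible_ind. *)
Definition irreducible X Y (f : homA X Y) : Prop :=
  [/\ ~ section_mor f, ~ retraction_mor f &
      forall Z (g : homA X Z) (h : homA Z Y), f = hcomp h g ->
        section_mor g \/ retraction_mor h].

Definition left_almost_split X Y (f : homA X Y) : Prop :=
  [/\ radical f, indecomposable X &
      forall U (u : homA X U), radical u -> exists u' : homA Y U, u = hcomp u' f].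

Definition right_almost_split X Y (f : homA X Y) : Prop :=
  [/\ radical f, indecomposable Y &
      forall U (u : homA U Y), radical u -> exists u' : homA U X, u = hcomp f u'].

Definition left_minimal X Y (f : homA X Y) : Prop :=
  forall h : homA Y Y, hcomp h f = f -> bijective h.

Definition right_minimal X Y (f : homA X Y) : Prop :=
  forall h : homA X X, hcomp f h = f -> bijective h.

Definition exact_at X Y Z (f : homA X Y) (g : homA Y Z) : Prop :=
  forall y, g y = 0 <-> exists x, f x = y.

Definition short_exact X Y Z (f : homA X Y) (g : homA Y Z) : Prop :=
  [/\ injective f, exact_at f g & hsurjective g].

Definition almost_split_sequence X Y Z (f : homA X Y) (g : homA Y Z) : Prop :=
  [/\ short_exact f g, irreducible f & irreducible g].

Definition superfluous_kernel X Y (f : homA X Y) : Prop :=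
  forall Z (h : homA Z X),
    (forall x, exists z y, x = h z + y /\ f y = 0) -> hsurjective h.

Definition minimal_projective_presentation (P1 P0 X : fgmod A)
    (p1 : homA P1 P0) (p0 : homA P0 X) : Prop :=
  [/\ projective_module P1 /\ projective_module P0, exact_at p1 p0,
      hsurjective p0, superfluous_kernel p1 & superfluous_kernel p0].

Definition regA : lmodType A^c := (A^c)^o.

Fact lmul_linear (X : lmodType A^c) (a : A) (g : homA X regA) :
  linear (fun x => @GRing.mul A a (g x) : regA).
Proof.
move=> b x y; rewrite linearP.
have /= : @GRing.mul A a (@GRing.mul A (g x) b + g y) =
  @GRing.mul A (@GRing.mul A a (g x)) b + @GRing.mul A a (g y).
  by rewrite mulrDr mulrA.
exact.
Qed.
Definition lmul (X : lmodType A^c) (a : A) (g : homA X regA) : homA X regA :=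
  mkhom (lmul_linear a g).

(* With Tr X the cokernel of Hom_A(p1, A) : Hom_A(P0, A) -> Hom_A(P1, A) and
   D = Hom_k(-, k), the module D Tr X is the space of the linear forms on
   Hom_A(P1, A) that vanish on the image of Hom_A(p1, A), with the right action
   (phi a)(g) = phi (a g); t identifies T with it. *)
Definition is_DTr X T : Prop :=
  exists (P1 P0 : fgmod A) (p1 : homA P1 P0) (p0 : homA P0 X)
         (t : T -> {scalar homA P1 regA}),
    minimal_projective_presentation p1 p0 /\
    [/\ forall x y g, t (x + y) g = t x g + t y g,
        forall (a : A) x g, t ((a : A^c) *: x) g = t x (lmul a g),
        forall x, (forall g, t x g = 0) -> x = 0 &
        forall phi : {scalar homA P1 regA},
          (forall h : homA P0 regA, phi (hcomp h p1) = 0) <->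
          (exists x, forall g, phi g = t x g)].

End ModuleNotions.

(* kcomp f g is "f followed by g". *)
Record kcategory (k : fieldType) (V : Type) : Type := KCategory {
  khom : V -> V -> lmodType k;
  kid : forall x, khom x x;
  kcomp : forall x y z, khom x y -> khom y z -> khom x z;
  kcompA : forall x y z w (f : khom x y) (g : khom y z) (h : khom z w),
    kcomp f (kcomp g h) = kcomp (kcomp f g) h;
  kcomp1l : forall x y (f : khom x y), kcomp (kid x) f = f;
  kcomp1r : forall x y (f : khom x y), kcomp f (kid y) = f;
  kcompPl : forall x y z (g : khom y z), linear (fun f : khom x y => kcomp f g);
  kcompPr : forall x y z (f : khom x y), linear (fun g : khom y z => kcomp f g)
}.

Record kfunctor (k : fieldType) (V : Type) (C D : kcategory k V) : Type :=
  KFunctor {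
    kfun :> forall x y, khom C x y -> khom D x y;
    kfunP : forall x y, linear (@kfun x y);
    kfun_id : forall x, kfun (kid C x) = kid D x;
    kfun_comp : forall x y z (f : khom C x y) (g : khom C y z),
      kfun (kcomp f g) = kcomp (kfun f) (kfun g)
  }.

Record kideal (k : fieldType) (V : Type) (C : kcategory k V) : Type := KIdeal {
  kideal_mem :> forall x y, khom C x y -> Prop;
  kideal0 : forall x y, kideal_mem (0 : khom C x y);
  kidealP : forall x y (c : k) (f g : khom C x y),
    kideal_mem f -> kideal_mem g -> kideal_mem (c *: f + g);
  kidealMl : forall x y z (f : khom C x y) (g : khom C y z),
    kideal_mem g -> kideal_mem (kcomp f g);
  kidealMr : forall x y z (f : khom C x y) (g : khom C y z),
    kideal_mem f -> kideal_mem (kcomp f g)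
}.

Section GeneratedIdeal.
Variables (k : fieldType) (V : Type) (C : kcategory k V).
Variable S : forall x y, khom C x y -> Prop.

Let mem x y (f : khom C x y) : Prop :=
  forall J : kideal C, (forall u v (g : khom C u v), S g -> J u v g) -> J x y f.

Fact gen0 x y : mem (0 : khom C x y).
Proof. by move=> J _; apply: kideal0. Qed.
Fact genP x y (c : k) (f g : khom C x y) : mem f -> mem g -> mem (c *: f + g).
Proof. by move=> If Ig J SJ; apply: kidealP; [apply: If|apply: Ig]. Qed.
Fact genMl x y z (f : khom C x y) (g : khom C y z) : mem g -> mem (kcomp f g).
Proof. by move=> Ig J SJ; apply: kidealMl; apply: Ig. Qed.
Fact genMr x y z (f : khom C x y) (g : khom C y z) : mem f -> mem (kcomp f g).
Proof. by move=> If J SJ; apply: kidealMr; apply: If. Qed.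

Definition generated_ideal : kideal C := KIdeal gen0 genP genMl genMr.
End GeneratedIdeal.

Section QuotientCategory.
Variables (k : fieldType) (V : Type) (C : kcategory k V) (I : kideal C).

Definition kideal_pred x y : {pred khom C x y} := fun f => `[< I x y f >].

Fact kideal_pred_zmod x y : zmod_closed (@kideal_pred x y).
Proof.
split=> [|f g /asboolP If /asboolP Ig]; apply/asboolP; first exact: kideal0.
by rewrite addrC -scaleN1r; apply: kidealP.
Qed.
HB.instance Definition _ x y :=
  GRing.isZmodClosed.Build (khom C x y) (@kideal_pred x y)
    (kideal_pred_zmod x y).

Definition kquot_hom (x y : V) : Type := {ideal_quot (@kideal_pred x y)}.
HB.instance Definition _ x y := GRing.Zmodule.on (kquot_hom x y).

Definition kclass x y (f : khom C x y) : kquot_hom x y :=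
  \pi_({ideal_quot (@kideal_pred x y)}) f.
Definition krepr x y (f : kquot_hom x y) : khom C x y :=
  repr (f : {ideal_quot (@kideal_pred x y)}).

Lemma kreprK x y : cancel (@krepr x y) (@kclass x y).
Proof. exact: reprK. Qed.

Lemma kclass_eqP x y (f g : khom C x y) : kclass f = kclass g <-> I x y (f - g).
Proof.
split=> [/eqP|Ifg]; last apply/eqP.
  by rewrite -Quotient.idealrBE => /asboolP.
by rewrite -Quotient.idealrBE; apply/asboolP.
Qed.

Lemma kreprP x y (f : khom C x y) : I x y (krepr (kclass f) - f).
Proof. by apply/kclass_eqP; rewrite kreprK. Qed.

Lemma kclassD x y (f g : khom C x y) : kclass (f + g) = kclass f + kclass g.
Proof. exact: (raddfD (\pi_({ideal_quot (@kideal_pred x y)}))). Qed.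

Definition kquot_scale x y (c : k) (f : kquot_hom x y) : kquot_hom x y :=
  kclass (c *: krepr f).

Lemma kclassZ x y (c : k) (f : khom C x y) :
  kquot_scale c (kclass f) = kclass (c *: f).
Proof.
apply/kclass_eqP; rewrite -scalerBr -[_ *: _]addr0.
by apply: kidealP; [apply: kreprP|apply: kideal0].
Qed.

Fact kquot_scaleA x y c d (f : kquot_hom x y) :
  kquot_scale c (kquot_scale d f) = kquot_scale (c * d) f.
Proof. by rewrite -[f]kreprK !kclassZ scalerA. Qed.
Fact kquot_scale1 x y : left_id 1 (@kquot_scale x y).
Proof. by move=> f; rewrite -[f]kreprK kclassZ scale1r. Qed.
Fact kquot_scaleDr x y : right_distributive (@kquot_scale x y) +%R.
Proof.
move=> c f g; rewrite -[f]kreprK -[g]kreprK -kclassD !kclassZ -kclassD.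
by rewrite scalerDr.
Qed.
Fact kquot_scaleDl x y (f : kquot_hom x y) :
  {morph (fun c : k => kquot_scale c f) : c d / c + d}.
Proof. by move=> c d; rewrite -[f]kreprK !kclassZ -kclassD scalerDl. Qed.
HB.instance Definition _ x y := GRing.Zmodule_isLmodule.Build k (kquot_hom x y)
  (@kquot_scaleA x y) (@kquot_scale1 x y) (@kquot_scaleDr x y)
  (@kquot_scaleDl x y).

Lemma kclassP x y : linear (@kclass x y).
Proof. by move=> c f g; rewrite kclassD -kclassZ. Qed.

Definition kquot_comp x y z (f : kquot_hom x y) (g : kquot_hom y z) :
  kquot_hom x z := kclass (kcomp (krepr f) (krepr g)).

Lemma kclass_comp x y z (f : khom C x y) (g : khom C y z) :
  kquot_comp (kclass f) (kclass g) = kclass (kcomp f g).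
Proof.
apply/kclass_eqP; set f' := krepr _; set g' := krepr _.
have -> : kcomp f' g' - kcomp f g =
    1 *: kcomp (f' - f) g' + kcomp f (g' - g).
  have -> : f' - f = (-1) *: f + f' by rewrite scaleN1r addrC.
  have -> : g' - g = (-1) *: g + g' by rewrite scaleN1r addrC.
  rewrite kcompPl kcompPr scale1r !scaleN1r [- kcomp f g' + _]addrC.
  by rewrite [- kcomp f g + _]addrC -addrA addKr.
by apply: kidealP; [apply: kidealMr|apply: kidealMl]; apply: kreprP.
Qed.

Fact kquot_compA x y z w (f : kquot_hom x y) (g : kquot_hom y z)
    (h : kquot_hom z w) :
  kquot_comp f (kquot_comp g h) = kquot_comp (kquot_comp f g) h.
Proof.
by rewrite -[f]kreprK -[g]kreprK -[h]kreprK !kclass_comp kcompA.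
Qed.
Fact kquot_comp1l x y (f : kquot_hom x y) :
  kquot_comp (kclass (kid C x)) f = f.
Proof. by rewrite -[f]kreprK kclass_comp kcomp1l. Qed.
Fact kquot_comp1r x y (f : kquot_hom x y) :
  kquot_comp f (kclass (kid C y)) = f.
Proof. by rewrite -[f]kreprK kclass_comp kcomp1r. Qed.
Fact kquot_compPl x y z (g : kquot_hom y z) :
  linear (fun f : kquot_hom x y => kquot_comp f g).
Proof.
move=> c f f'; rewrite -[f]kreprK -[f']kreprK -[g]kreprK -kclassP.
by rewrite !kclass_comp kcompPl kclassP.
Qed.
Fact kquot_compPr x y z (f : kquot_hom x y) :
  linear (fun g : kquot_hom y z => kquot_comp f g).
Proof.
move=> c g g'; rewrite -[f]kreprK -[g]kreprK -[g']kreprK -kclassP.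
by rewrite !kclass_comp kcompPr kclassP.
Qed.

Definition kquotient : kcategory k V :=
  @KCategory k V (fun x y => kquot_hom x y) (fun x => kclass (kid C x))
    kquot_comp kquot_compA kquot_comp1l kquot_comp1r kquot_compPl kquot_compPr.

End QuotientCategory.

Inductive qpath (V : Type) (arr : V -> V -> Type) : V -> V -> Type :=
| qnil x : qpath arr x x
| qcons x y z : arr x y -> qpath arr y z -> qpath arr x z.
Arguments qnil {V arr} x.

Fixpoint qcat (V : Type) (arr : V -> V -> Type) (x y z : V)
    (p : qpath arr x y) : qpath arr y z -> qpath arr x z :=
  match p with
  | qnil _ => fun q => q
  | qcons _ _ _ a p' => fun q => qcons a (qcat p' q)
  end.

Section PathCategory.
Variables (k : fieldType) (V : Type) (arr : V -> V -> Type).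
Local Notation path := (qpath arr).

HB.instance Definition _ x y := gen_eqMixin (path x y).
HB.instance Definition _ x y := gen_choiceMixin (path x y).

Lemma qcatA x y z w (p : path x y) (q : path y z) (r : path z w) :
  qcat p (qcat q r) = qcat (qcat p q) r.
Proof. by elim: p q => //= x' y' z' a p IH q; rewrite IH. Qed.
Lemma qcat1r x y (p : path x y) : qcat p (qnil y) = p.
Proof. by elim: p => //= x' y' z' a p ->. Qed.

Definition lin_ext (K : choiceType) (M : lmodType k) (F : K -> M)
  (u : {malg k[K]}) : M := \sum_(p <- msupp u) mcoeff p u *: F p.

Lemma lin_extEw (K : choiceType) (M : lmodType k) (F : K -> M)
    (d : {fset K}) (u : {malg k[K]}) : (msupp u `<=` d)%fset ->
  lin_ext F u = \sum_(p <- d) mcoeff p u *: F p.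
Proof.
move=> ud; rewrite /lin_ext (big_fset_incl _ ud) //= => p _ /mcoeff_outdom ->.
by rewrite scale0r.
Qed.

Lemma lin_extP (K : choiceType) (M : lmodType k) (F : K -> M) :
  linear (lin_ext F).
Proof.
move=> c u v; pose d := (msupp (c *: u + v) `|` msupp u `|` msupp v)%fset.
rewrite !(@lin_extEw _ _ _ d) /d; last 3 first.
- exact: fsubsetUr.
- by rewrite -fsetUA fsetUC -fsetUA fsubsetUl.
- by rewrite -fsetUA fsubsetUl.
rewrite scaler_sumr -big_split; apply: eq_bigr => p _ /=.
by rewrite mcoeffD mcoeffZ scalerDl scalerA.
Qed.

Lemma lin_extU (K : choiceType) (M : lmodType k) (F : K -> M) (p : K) :
  lin_ext F (mkmalgU p 1) = F p.
Proof.
rewrite (@lin_extEw _ _ _ [fset p]%fset) ?msuppU_le // big_seq_fset1.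
by rewrite mcoeffUU scale1r.
Qed.

Lemma lin_ext_uniq (K : choiceType) (M : lmodType k) (L L' : {malg k[K]} -> M) :
  linear L -> linear L' -> (forall p, L (mkmalgU p 1) = L' (mkmalgU p 1)) ->
  L =1 L'.
Proof.
move=> lL lL' LL' u.
pose l : {linear {malg k[K]} -> M} :=
  HB.pack L (GRing.isLinear.Build k {malg k[K]} M *:%R L lL).
pose l' : {linear {malg k[K]} -> M} :=
  HB.pack L' (GRing.isLinear.Build k {malg k[K]} M *:%R L' lL').
rewrite -[L u]/(l u) -[L' u]/(l' u) [u]monalgE !linear_sum /=.
apply: eq_bigr => p _.
have -> : mkmalgU p (mcoeff p u) = mcoeff p u *: mkmalgU p 1 :> {malg k[K]}.
  by apply/malgP => q; rewrite mcoeffZ !mcoeffU mulr_natr.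
rewrite -[LHS]/(l (_ *: _)) -[RHS]/(l' (_ *: _)) !linearZ.
by congr (_ *: _); apply: LL'.
Qed.

Definition path_hom (x y : V) : lmodType k := {malg k[path x y]}.

Definition path_class x y (p : path x y) : path_hom x y := mkmalgU p 1.

Definition path_comp x y z (f : path_hom x y) (g : path_hom y z) :
    path_hom x z :=
  lin_ext (fun p => lin_ext (fun q => path_class (qcat p q)) g) f.

Lemma path_comp_class x y z (p : path x y) (q : path y z) :
  path_comp (path_class p) (path_class q) = path_class (qcat p q).
Proof. by rewrite /path_comp !lin_extU. Qed.

Fact path_compPl x y z (g : path_hom y z) :
  linear (fun f : path_hom x y => path_comp f g).
Proof. exact: lin_extP. Qed.
Fact path_compPr x y z (f : path_hom x y) :
  linear (fun g : path_hom y z => path_comp f g).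
Proof.
move=> c g g'; rewrite /path_comp /lin_ext scaler_sumr -big_split.
apply: eq_bigr => p _ /=.
by rewrite -!/(lin_ext _ _) lin_extP scalerDr !scalerA mulrC.
Qed.

Fact path_compA x y z w (f : path_hom x y) (g : path_hom y z)
    (h : path_hom z w) :
  path_comp f (path_comp g h) = path_comp (path_comp f g) h.
Proof.
move: f; apply: lin_ext_uniq => [|c u v|p].
- exact: path_compPl.
- by rewrite !path_compPl.
move: g; apply: lin_ext_uniq => [c u v|c u v|q].
- by rewrite path_compPl path_compPr.
- by rewrite path_compPr path_compPl.
move: h; apply: lin_ext_uniq => [c u v|c u v|r].
- by rewrite !path_compPr.
- by rewrite path_compPr.
by rewrite -!/(path_class _) !path_comp_class qcatA.
Qed.
Fact path_comp1l x y (f : path_hom x y) : path_comp (path_class (qnil x)) f = f.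
Proof.
move: f; apply: lin_ext_uniq => [c u v|//|p]; first by rewrite path_compPr.
by rewrite -!/(path_class _) path_comp_class.
Qed.
Fact path_comp1r x y (f : path_hom x y) : path_comp f (path_class (qnil y)) = f.
Proof.
move: f; apply: lin_ext_uniq => [c u v|//|p]; first by rewrite path_compPl.
by rewrite -!/(path_class _) path_comp_class qcat1r.
Qed.

Definition path_category : kcategory k V :=
  @KCategory k V path_hom (fun x => path_class (qnil x)) path_comp
    path_compA path_comp1l path_comp1r path_compPl path_compPr.

End PathCategory.

Record ar_component (k : fieldType) (A : falgType k) : Type := ARComponent {
  vert : Type;
  rep : vert -> fgmod A;
  rep_indec : forall x, indecomposable (rep x);
  rep_skeletal : forall x y, isomorphic (rep x) (rep y) -> x = y;
  arr : vert -> vert -> finType;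
  arr_dim : forall x y, rad_quotient_dim (rep x) (rep y) #|arr x y|;
  vert_inhabited : inhabited vert;
  vert_connected : forall x y,
    clos_refl_sym_trans vert (fun u v => inhabited (arr u v)) x y;
  (* a component contains every neighbour, in the whole Auslander-Reiten quiver,
     of its vertices *)
  vert_closed : forall x (N : fgmod A), indecomposable N ->
    (exists f : homA (rep x) N, irreducible_ind f) \/
    (exists f : homA N (rep x), irreducible_ind f) ->
    exists y, isomorphic N (rep y);
  (* The translation is only defined on the non-projective vertices. As in any
     translation quiver, it is a bijection onto the non-injective ones. *)
  nonprojective := {x : vert | ~ projective_module (rep x)};
  tau : nonprojective -> vert;
  tau_DTr : forall x, is_DTr (rep (sval x)) (rep (tau x));
  tau_noninjective : forall x, ~ injective_module (rep (tau x));
  tau_inj : forall x y, tau x = tau y -> sval x = sval y;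
  tau_surj : forall y, ~ injective_module (rep y) -> exists x, tau x = y;
  sigma : forall (x : nonprojective) (y : vert), arr y (sval x) -> arr (tau x) y;
  sigma_bij : forall x y, bijective (@sigma x y)
}.

Section RiedtmannFunctors.
Variables (k : fieldType) (A : falgType k) (G : ar_component A).

(* The arrows ending at, and starting at, a given vertex. The phrase
   "a_1, ..., a_r are all the arrows ending at x" is: a : 'I_r -> arr_to x is
   bijective. *)
Definition arr_to (x : vert G) : Type := {y : vert G & arr y x}.
Definition arr_from (x : vert G) : Type := {y : vert G & arr x y}.

Definition kpath : kcategory k (vert G) :=
  path_category k (fun x y : vert G => arr x y).

Inductive mesh_relation : forall x y, khom kpath x y -> Prop :=
| MeshRelation (x : nonprojective G) (r : nat) (a : 'I_r -> arr_to (sval x)) :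
    bijective a ->
    mesh_relation
      (\sum_(i < r) (path_class k
         (qcons (sigma (tagged (a i))) (qcons (tagged (a i)) (qnil (sval x))))
       : khom kpath (tau x) (sval x))).

Definition mesh_ideal : kideal kpath := generated_ideal mesh_relation.

Definition mesh_category : kcategory k (vert G) := kquotient mesh_ideal.

Definition arrow_class (x y : vert G) (a : arr x y) : khom mesh_category x y :=
  kclass mesh_ideal (path_class k (qcons a (qnil y)) : khom kpath x y).

Fact ind_compPl (x y z : vert G) (g : homA (rep y) (rep z)) :
  linear (fun f : homA (rep x) (rep y) => hcomp g f).
Proof.
move=> c f f'; apply: homA_ext => u /=.
by rewrite linearP.
Qed.
Fact ind_compPr (x y z : vert G) (f : homA (rep x) (rep y)) :
  linear (fun g : homA (rep y) (rep z) => hcomp g f).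
Proof. by move=> c g g'; apply: homA_ext. Qed.

Fact ind_compA (x y z w : vert G) (f : homA (rep x) (rep y))
    (g : homA (rep y) (rep z)) (h : homA (rep z) (rep w)) :
  hcomp (hcomp h g) f = hcomp h (hcomp g f).
Proof. exact: homA_ext. Qed.
Fact ind_comp1l (x y : vert G) (f : homA (rep x) (rep y)) :
  hcomp f (hid (rep x)) = f.
Proof. exact: homA_ext. Qed.
Fact ind_comp1r (x y : vert G) (f : homA (rep x) (rep y)) :
  hcomp (hid (rep y)) f = f.
Proof. exact: homA_ext. Qed.

Definition ind_category : kcategory k (vert G) :=
  @KCategory k (vert G) (fun x y => homA (rep x) (rep y))
    (fun x => hid (rep x)) (fun x y z f g => hcomp g f)
    ind_compA ind_comp1l ind_comp1r ind_compPl ind_compPr.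

(* F X = X holds because a kfunctor is the identity on objects. *)
Definition Riedtmann (F : kfunctor mesh_category ind_category) : Prop :=
  (forall x r (a : 'I_r -> arr_from x), bijective a ->
     let f := hcol (fun i => F _ _ (arrow_class (tagged (a i)))) in
     left_minimal f /\ left_almost_split f) /\
  (forall x r (a : 'I_r -> arr_to x), bijective a ->
     let f := hrow (fun i => F _ _ (arrow_class (tagged (a i)))) in
     right_minimal f /\ right_almost_split f).

Definition mesh_comparable : Prop :=
  exists F : kfunctor mesh_category ind_category, Riedtmann F.

End RiedtmannFunctors.

(* Main.v *)
(* (a) => (b): take f_a = F(a). The components of a right minimal almost split
   map are irreducible; to apply this to an arrow ending at Y one needs that only
   finitely many arrows end at Y, which follows from the existence of a right
   almost split map ending at Y. For a mesh, the column f and the row g are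
   minimal almost split with g f = 0, f is injective and g is surjective. Since f
   is irreducible, tau X is a direct summand of ker g, and the minimality of g
   excludes a complement, as f is not a section.
   (b) => (a): the two maps of an almost split sequence with indecomposable end
   terms are left and right almost split. Hence at every vertex the row and the
   column of the f_a are almost split. Then the f_a span the spaces rad/rad^2
   and, their number being the dimension, form bases. As k is algebraically
   closed, this implies that every r with row r = 0 is radical, so that every h
   with row h = row is 1 plus a radical map, hence invertible: the row is right
   minimal. The functor evaluates paths, and kills the mesh relations because
   g f = 0 in each mesh. *)

From HB Require Import structures.
Require Import Defs.

Set Implicit Arguments.
Unset Strict Implicit.
Unset Printing Implicit Defensive.

Import GRing.Theory.
Local Open Scope ring_scope.
Local Open Scope quotient_scope.

(** * Modules as finite-dimensional vector spaces *)

(** An [ar_component] gives each translate only as a module D Tr X, with no almost split sequence,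
    so the right almost split map that bounds the number of arrows has to be constructed. Each arrow
    is treated at its end, which is why this is done on the right-hand side alone. Over a projective
    vertex the map is the inclusion of the radical; over a non-projective one it is a pushout of a
    projective presentation along a map chosen by extending linear forms. Algebraic closedness
    enters through eigenvalues: an endomorphism of an indecomposable is a scalar plus a radical map.
    A composite of the row of the [f_a] with an arbitrary map is therefore, modulo the square of the
    radical, a k-linear combination of arrows, and linear independence of the arrows forces the
    scalars of a relation to vanish. Decompositions, locality and the invertibility of 1 plus a
    radical map all rest on Fitting's lemma. *)

Lemma lmod_min_basis (k : fieldType) (V : lmodType k) (I : finType) (g : I ->
  V) :
  (forall x, exists a : I -> k, x = \sum_i a i *: g i) ->
  exists n (v : V -> 'rV[k]_n), linear v /\ bijective v.
Proof.
move=> gspan.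
pose P n := `[< exists h : 'I_n -> V,
  forall x, exists a : 'I_n -> k, x = \sum_i a i *: h i >].
have exP : exists n, P n.
  exists #|I|; apply/asboolP; exists (fun i => g (enum_val i)) => x.
  have [a ->] := gspan x; exists (fun i => a (enum_val i)).
  by rewrite (big_enum_val (A := I) (fun i => a i *: g i)); apply: eq_bigl.
case: (ex_minnP exP) => n /asboolP[h hspan] nmin; exists n.
pose L (r : 'rV[k]_n) : V := \sum_i r 0 i *: h i.
have Llin : linear L.
  move=> c u v; rewrite /L scaler_sumr -big_split; apply: eq_bigr => i _ /=.
  by rewrite !mxE scalerDl scalerA.
have Lsurj y : exists r, L r = y.
  have [a ->] := hspan y; exists (\row_i a i).
  by apply: eq_bigr => i _; rewrite mxE.
have Lker r : L r = 0 -> r = 0.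
  move=> Lr0; apply: contrapT => r0.
  have [j rj] : exists j, r 0 j != 0.
    apply: contrapT => nj; apply: r0; apply/rowP => j; rewrite mxE.
    by apply/eqP; apply/negPn/negP => rj; apply: nj; exists j.
  (* The index [j] rules out [n = 0]. The relation expresses [h j] through the other vectors, which
     then span and contradict [nmin]. *)
  case: n => [|n] in h hspan nmin L Llin Lsurj r Lr0 r0 j rj *; first by case:
    j {rj}.
  suff /nmin : P n by rewrite ltnn.
  apply/asboolP; exists (fun i => h (lift j i)) => x.
  have [a ->] := hspan x.
  have hj : h j = - \sum_i (r 0 j)^-1 * r 0 (lift j i) *: h (lift j i).
    have : (r 0 j)^-1 *: L r = 0 by rewrite Lr0 scaler0.
    rewrite /L (bigD1_ord j) //= scalerDr scalerA mulVf // scale1r => /eqP.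
    rewrite addr_eq0 => /eqP ->; congr (- _); rewrite scaler_sumr.
    by apply: eq_bigr => i _; rewrite scalerA.
  exists (fun i => a (lift j i) - a j * ((r 0 j)^-1 * r 0 (lift j i))).
  rewrite (bigD1_ord j) //= hj scalerN scaler_sumr addrC -sumrB.
  by apply: eq_bigr => i _; rewrite scalerBl scalerA.
have [v vK Kv] : bijective L.
  have [v Hv] := choice Lsurj.
  exists v => // r; apply/eqP; rewrite -subr_eq0; apply/eqP/Lker.
  by rewrite -scaleN1r addrC Llin Hv scaleN1r addNr.
exists v; split; last by exists L.
move=> c x y; apply: (can_inj vK); rewrite Llin.
by rewrite -[in LHS](Kv x) -[in LHS](Kv y) !Kv.
Qed.

Section FiniteDimension.
Variables (k : fieldType) (A : falgType k).
Implicit Types X Y Z : fgmod A.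

(** A separate name for the same elements, so that the vector space structure over [k] and its
    dimension theory can sit beside the [A]-module structure. *)
Definition kmod X : Type := X.
HB.instance Definition _ X := GRing.Zmodule.on (kmod X).

Definition kmod_scale X (c : k) (x : kmod X) : kmod X :=
  (c%:A : A^c) *: (x : X).

Lemma algcM (c d : k) : (c%:A : A^c) * (d%:A : A^c) = (c * d)%:A.
Proof.
have /= : @GRing.mul A d%:A c%:A = (c * d)%:A by rewrite mulr_algr scalerA.
exact.
Qed.

Fact kmod_scaleA X c d (x : kmod X) :
  kmod_scale c (kmod_scale d x) = kmod_scale (c * d) x.
Proof. by rewrite /kmod_scale scalerA algcM. Qed.
Fact kmod_scale1 X : left_id 1 (@kmod_scale X).
Proof. by move=> x; rewrite /kmod_scale !scale1r. Qed.
Fact kmod_scaleDr X : right_distributive (@kmod_scale X) +%R.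
Proof. by move=> c x y; apply: scalerDr. Qed.
Fact kmod_scaleDl X (x : kmod X) :
  {morph (fun c : k => kmod_scale c x) : c d / c + d}.
Proof. by move=> c d; rewrite /kmod_scale !scalerDl. Qed.
HB.instance Definition _ X := GRing.Zmodule_isLmodule.Build k (kmod X)
  (@kmod_scaleA X) (@kmod_scale1 X) (@kmod_scaleDr X) (@kmod_scaleDl X).

Lemma kmodZ X c (x : kmod X) : c *: x = (c%:A : A^c) *: (x : X) :> X.
Proof. by []. Qed.

Lemma kmod_span X : exists (I : finType) (g : I -> kmod X),
  forall x, exists a : I -> k, x = \sum_i a i *: g i.
Proof.
have [n [g gspan]] := fgmod_fg X.
pose e := vbasis (@fullv k A).
pose d := \dim (@fullv k A).
pose h (i : 'I_n) (j : 'I_d) : kmod X := (e`_j : A^c) *: g i.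
exists ('I_n * 'I_d)%type, (fun ij => h ij.1 ij.2) => x.
have [a ->] := gspan x; exists (fun ij => coord e ij.2 (a ij.1)).
rewrite -(pair_bigA _ (fun i j => coord e j (a i) *: h i j)) /=.
apply: eq_bigr => i _.
rewrite {1}(coord_vbasis (memvf (a i : A))).
rewrite [LHS](_ : _ = \sum_(j < d)
  ((coord e j (a i) *: e`_j : A) : A^c) *: g i); last first.
  exact: (big_morph (fun b : A^c => b *: g i) (fun b c => scalerDl _ b c)
    (scale0r _)).
apply: eq_bigr => j _; rewrite kmodZ scalerA.
have -> // : coord e j (a i) *: e`_j = @GRing.mul A e`_j (coord e j (a i))%:A.
by rewrite mulr_algr.
Qed.

(** [vector_axiom] is a type of data; wrapping it in an existential proposition allows a proof by
    existence, from which [cid] extracts the data for the instance below. *)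
Fact kmod_vector X : exists n, exists _ : vector_axiom n (kmod X), True.
Proof.
have [I [g gspan]] := kmod_span X.
have [n [v [vlin vbij]]] := lmod_min_basis gspan.
by exists n; exists (exist2 _ _ v vlin vbij).
Qed.
HB.instance Definition _ X := Lmodule_hasFinDim.Build k (kmod X)
  (projT1 (cid (projT2 (cid (kmod_vector X))))).

Definition kdim X : nat := \dim (@fullv k (kmod X)).
End FiniteDimension.


(** * Submodules, quotients, pullbacks and pushouts *)

(** The ring is arbitrary because quotients are taken both of [A]-modules and of Hom spaces over [k]
    modulo the square of the radical. *)
Record submodule (R : nzRingType) (M : lmodType R) : Type := Submodule {
  submodule_mem :> M -> Prop;
  submodule0 : submodule_mem 0;
  submoduleP : forall a x y,
    submodule_mem x -> submodule_mem y -> submodule_mem (a *: x + y)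
}.

Section SubQuotient.
Variables (R : nzRingType) (M : lmodType R) (S : submodule M).

Definition submodule_pred : {pred M} := fun x => `[< S x >].
Fact submodule_pred_closed : submod_closed submodule_pred.
Proof.
split=> [|a x y /asboolP Sx /asboolP Sy]; apply/asboolP; first exact:
  submodule0.
exact: submoduleP.
Qed.
HB.instance Definition _ :=
  GRing.isSubmodClosed.Build R M submodule_pred submodule_pred_closed.

Definition sub_car : Type := {x | x \in submodule_pred}.
HB.instance Definition _ := SubChoice.on sub_car.
HB.instance Definition _ := [SubChoice_isSubLmodule of sub_car by <:].

Definition to_sub (x : M) (Sx : S x) : sub_car :=
  exist (fun y => y \in submodule_pred) x (introT (asboolP (S x)) Sx).

Definition quo_car : Type := {ideal_quot submodule_pred}.
HB.instance Definition _ := GRing.Zmodule.on quo_car.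

Definition quo_class (x : M) : quo_car := \pi_({ideal_quot submodule_pred}) x.
Definition quo_repr (q : quo_car) : M := repr (q : {ideal_quot submodule_pred}).

Lemma quo_reprK : cancel quo_repr quo_class.
Proof. exact: reprK. Qed.

Lemma quo_class_eqP x y : quo_class x = quo_class y <-> S (x - y).
Proof.
split=> [/eqP|Sxy]; first by rewrite -Quotient.idealrBE => /asboolP.
by apply/eqP; rewrite -Quotient.idealrBE; apply/asboolP.
Qed.

Lemma quo_classD x y : quo_class (x + y) = quo_class x + quo_class y.
Proof. exact: (raddfD (\pi_({ideal_quot submodule_pred}))). Qed.

Definition quo_scale (a : R) (q : quo_car) : quo_car :=
  quo_class (a *: quo_repr q).

Lemma quo_classZ a x : quo_scale a (quo_class x) = quo_class (a *: x).
Proof.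
apply/quo_class_eqP; rewrite -scalerBr -[_ *: _]addr0.
by apply: submoduleP; [apply/quo_class_eqP/quo_reprK | apply: submodule0].
Qed.

Fact quo_scaleA a b q : quo_scale a (quo_scale b q) = quo_scale (a * b) q.
Proof. by rewrite -[q]quo_reprK !quo_classZ scalerA. Qed.
Fact quo_scale1 : left_id 1 quo_scale.
Proof. by move=> q; rewrite -[q]quo_reprK quo_classZ scale1r. Qed.
Fact quo_scaleDr : right_distributive quo_scale +%R.
Proof.
move=> a q r; rewrite -[q]quo_reprK -[r]quo_reprK -quo_classD !quo_classZ.
by rewrite -quo_classD scalerDr.
Qed.
Fact quo_scaleDl q : {morph quo_scale^~ q : a b / a + b}.
Proof.
by move=> a b; rewrite -[q]quo_reprK !quo_classZ -quo_classD scalerDl.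
Qed.
HB.instance Definition _ := GRing.Zmodule_isLmodule.Build R quo_car
  quo_scaleA quo_scale1 quo_scaleDr quo_scaleDl.

Fact quo_class_linear : linear quo_class.
Proof. by move=> a x y; rewrite quo_classD -quo_classZ. Qed.

Lemma quo_fg : finitely_generated M -> finitely_generated (quo_car : lmodType
  R).
Proof.
move=> [n [g gspan]]; exists n, (fun i => quo_class (g i)) => q.
have [a qa] := gspan (quo_repr q); exists a.
rewrite -[LHS]quo_reprK qa.
pose l : {linear M -> quo_car} :=
  HB.pack quo_class (GRing.isLinear.Build R M quo_car *:%R _ quo_class_linear).
rewrite -[LHS]/(l _) linear_sum; apply: eq_bigr => i _.
by rewrite linearZ.
Qed.

End SubQuotient.

Section HomCalculus.
Variables (k : fieldType) (A : falgType k).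
Implicit Types W X Y Z : lmodType A^c.

Lemma hom_addE X Y (f g : homA X Y) x : (f + g) x = f x + g x.
Proof. by []. Qed.
Lemma hom_oppE X Y (f : homA X Y) x : (- f) x = - f x.
Proof. by []. Qed.
Lemma hom0E X Y x : (0 : homA X Y) x = 0.
Proof. by []. Qed.
Lemma hom_scaleE X Y c (f : homA X Y) x : (c *: f) x = (c%:A : A^c) *: f x.
Proof. by []. Qed.
Lemma hom_sumE X Y I (s : seq I) (Q : pred I) (f : I -> homA X Y) x :
  (\sum_(i <- s | Q i) f i) x = \sum_(i <- s | Q i) f i x.
Proof. exact: (big_morph (fun h : homA X Y => h x) (fun f g => erefl) erefl).
  Qed.

Lemma hcompA X Y Z W (h : homA Z W) (g : homA Y Z) (f : homA X Y) :
  hcomp h (hcomp g f) = hcomp (hcomp h g) f.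
Proof. exact: homA_ext. Qed.
Lemma hcomp1 X Y (f : homA X Y) : hcomp (hid Y) f = f.
Proof. exact: homA_ext. Qed.
Lemma hcompf1 X Y (f : homA X Y) : hcomp f (hid X) = f.
Proof. exact: homA_ext. Qed.
Lemma hcomp0 X Y Z (f : homA X Y) : hcomp (0 : homA Y Z) f = 0.
Proof. exact: homA_ext. Qed.
Lemma hcompf0 X Y Z (f : homA Y Z) : hcomp f (0 : homA X Y) = 0.
Proof. by apply: homA_ext => x /=; rewrite linear0. Qed.
Lemma hcompDl X Y Z (f g : homA Y Z) (h : homA X Y) :
  hcomp (f + g) h = hcomp f h + hcomp g h.
Proof. exact: homA_ext. Qed.
Lemma hcompDr X Y Z (f : homA Y Z) (g h : homA X Y) :
  hcomp f (g + h) = hcomp f g + hcomp f h.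
Proof. by apply: homA_ext => x /=; rewrite linearD. Qed.
Lemma hcompNl X Y Z (f : homA Y Z) (h : homA X Y) :
  hcomp (- f) h = - hcomp f h.
Proof. exact: homA_ext. Qed.
Lemma hcompNr X Y Z (f : homA Y Z) (g : homA X Y) :
  hcomp f (- g) = - hcomp f g.
Proof. by apply: homA_ext => x /=; rewrite linearN. Qed.
Lemma hcompZl X Y Z c (f : homA Y Z) (g : homA X Y) :
  hcomp (c *: f) g = c *: hcomp f g.
Proof. exact: homA_ext. Qed.
Lemma hcompZr X Y Z c (f : homA Y Z) (g : homA X Y) :
  hcomp f (c *: g) = c *: hcomp f g.
Proof. by apply: homA_ext => x; rewrite /= linearZ. Qed.
Lemma hcomp_suml X Y Z I (s : seq I) (Q : pred I) (f : I -> homA Y Z)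
    (h : homA X Y) :
  hcomp (\sum_(i <- s | Q i) f i) h = \sum_(i <- s | Q i) hcomp (f i) h.
Proof.
exact: (big_morph (fun g => hcomp g h) (fun f g => hcompDl f g h) (hcomp0 Z h)).
Qed.
Lemma hcomp_sumr X Y Z I (s : seq I) (Q : pred I) (f : I -> homA X Y)
    (h : homA Y Z) :
  hcomp h (\sum_(i <- s | Q i) f i) = \sum_(i <- s | Q i) hcomp h (f i).
Proof.
exact: (big_morph (fun g => hcomp h g) (hcompDr h) (hcompf0 X h)).
Qed.

End HomCalculus.

Section Modules.
Variables (k : fieldType) (A : falgType k).
Implicit Types M N P U V W X Y Z : fgmod A.

Lemma inj_homP X Y (f : homA X Y) :
  (forall x, f x = 0 -> x = 0) -> injective f.
Proof.
move=> f0 x y fxy; apply/eqP; rewrite -subr_eq0; apply/eqP/f0.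
by rewrite linearB fxy subrr.
Qed.

Lemma inj_surj_bij X Y (f : homA X Y) :
  injective f -> hsurjective f -> bijective f.
Proof. by move=> finj /choice[g gK]; exists g => // x; apply: finj. Qed.

Lemma bij_surj X Y (f : homA X Y) : bijective f -> hsurjective f.
Proof. by case=> g _ gK y; exists (g y). Qed.

Lemma hom_inv X Y (f : homA X Y) : bijective f ->
  exists g : homA Y X, hcomp g f = hid X /\ hcomp f g = hid Y.
Proof.
case=> g fK gK.
have glin : linear g by move=> a x y; apply: (can_inj fK); rewrite linearP !gK.
by exists (mkhom glin); split; apply: homA_ext => x /=; rewrite ?fK ?gK.
Qed.

Lemma hid_bij X : bijective (hid X).
Proof. by exists id. Qed.

Lemma hinv_bij X Y (f : homA X Y) (g : homA Y X) :
  hcomp g f = hid X -> hcomp f g = hid Y -> bijective f.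
Proof.
move=> gf fg; exists g => x.
  by rewrite -[RHS]/(hid X x) -gf.
by rewrite -[RHS]/(hid Y x) -fg.
Qed.

Lemma hcomp_bij X Y Z (g : homA Y Z) (f : homA X Y) :
  bijective g -> bijective f -> bijective (hcomp g f).
Proof. exact: bij_comp. Qed.

Lemma section_inj X Y (f : homA X Y) : section_mor f -> injective f.
Proof.
case=> g gf; apply: (can_inj (g := g)) => x.
by rewrite -[RHS]/(hid X x) -gf.
Qed.

Lemma retraction_surj X Y (f : homA X Y) : retraction_mor f -> hsurjective f.
Proof. by case=> g fg y; exists (g y); rewrite -[RHS]/(hid Y y) -fg. Qed.

Section Linear.
Variables (X Y : fgmod A) (f : homA X Y).
Definition klin : kmod X -> kmod Y := f.
Fact klin_linear : linear klin.
Proof. by move=> c x y; rewrite /klin linearD kmodZ linearZ. Qed.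
HB.instance Definition _ :=
  GRing.isLinear.Build k (kmod X) (kmod Y) *:%R klin klin_linear.
End Linear.

Lemma linfunE X Y (f : homA X Y) x : linfun (klin f) x = f x.
Proof. exact: lfunE. Qed.

Lemma inj_kdim X Y (f : homA X Y) :
  injective f -> \dim (limg (linfun (klin f))) = kdim X.
Proof.
move=> finj; rewrite /kdim -(limg_ker_dim (linfun (klin f)) fullv).
have -> : lker (linfun (klin f)) = 0%VS.
  by apply/eqP/lker0P => x y; rewrite !linfunE; apply: finj.
by rewrite capv0 dimv0.
Qed.

Lemma inj_bij X Y (f : homA X Y) :
  injective f -> (kdim Y <= kdim X)%N -> bijective f.
Proof.
move=> finj YX; apply: inj_surj_bij => // y.
have : (y : kmod Y) \in limg (linfun (klin f)).
  rewrite (_ : limg _ = fullv) ?memvf //; apply/eqP.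
  by rewrite eqEdim subvf inj_kdim.
by case/memv_imgP => x _ ->; exists x; rewrite linfunE.
Qed.

Lemma inj_nonsurj_kdim X Y (f : homA X Y) :
  injective f -> ~ hsurjective f -> (kdim X < kdim Y)%N.
Proof.
move=> finj fns; rewrite ltnNge; apply/negP => YX; apply: fns.
exact/bij_surj/inj_bij.
Qed.

(* A linearly closed predicate is spanned by a subspace of maximal dimension
   contained in it. *)
Lemma submodule_exists X (S : submodule X) :
  exists (K : fgmod A) (i : homA K X),
    injective i /\ forall x, S x <-> exists y, i y = x.
Proof.
pose inS (E : {vspace (kmod X)}) := forall x, x \in E -> S x.
have exE : exists n, `[< exists2 E, inS E & \dim E = n >].
  exists 0%N; apply/asboolP; exists 0%VS; last exact: dimv0.
  by move=> x; rewrite memv0 => /eqP->; apply: submodule0.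
have maxE n : `[< exists2 E, inS E & \dim E = n >] -> (n <= kdim X)%N.
  by move=> /asboolP[E _ <-]; apply/dimvS/subvf.
case: (ex_maxnP exE maxE) => n /asboolP[E ES En] Emax.
have SE x : S x -> (x : kmod X) \in E.
  move=> Sx; apply/negPn/negP => xE.
  have : (\dim (E + <[x : kmod X]>) <= n)%N.
    apply: Emax; apply/asboolP; exists (E + <[x : kmod X]>)%VS => // y.
    move=> /memv_addP[u uE [v /vlineP[c ->] ->]].
    by rewrite addrC; apply: submoduleP => //; apply: ES.
  rewrite -En => le; move: xE; apply/negP/negPn.
  have /eqP -> : E == (E + <[x : kmod X]>)%VS by rewrite eqEdim addvSl.
  by apply: (subvP (addvSr _ _)); apply: memv_line.
pose e := vbasis E.
have eS (i : nat) : (i < \dim E)%N -> S e`_i.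
  by move=> ltiE; apply/ES/vbasis_mem/mem_nth; rewrite size_tuple.
have fgS : finitely_generated (sub_car S : lmodType A^c).
  exists (\dim E), (fun i : 'I_(\dim E) => to_sub (eS i (ltn_ord i))) => x.
  have xE : (val x : kmod X) \in E by apply/SE/asboolP/(valP x).
  exists (fun i => (coord e i (val x))%:A); apply: val_inj.
  rewrite [LHS](coord_vbasis xE) raddf_sum; exact: eq_bigr.
have val_lin : linear (val : sub_car S -> X) by move=> a x y; apply: linearP.
exists (FgMod fgS), (mkhom val_lin : homA (FgMod fgS) X).
split; first exact: val_inj.
move=> x; split=> [Sx|[y <-]]; last exact/asboolP/(valP y).
by exists (to_sub Sx).
Qed.

Lemma quotient_exists X (S : submodule X) :
  exists (Q : fgmod A) (p : homA X Q),
    hsurjective p /\ forall x, p x = 0 <-> S x.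
Proof.
exists (FgMod (quo_fg S (fgmod_fg X))), (mkhom (quo_class_linear S)); split.
  by move=> q; exists (quo_repr q); apply: quo_reprK.
move=> x; split=> [/= x0|Sx].
  rewrite -[x]subr0; apply/quo_class_eqP.
  by rewrite x0; apply/esym; apply: (linear0 (mkhom (quo_class_linear S))).
rewrite -(linear0 (mkhom (quo_class_linear S))) /=; apply/quo_class_eqP.
by rewrite subr0.
Qed.

Lemma ker_exists X Y (f : homA X Y) :
  exists (K : fgmod A) (i : homA K X), injective i /\ exact_at i f.
Proof.
have f0 : f 0 = 0 by rewrite linear0.
have fP a x y : f x = 0 -> f y = 0 -> f (a *: x + y) = 0.
  by move=> fx fy; rewrite linearP fx fy scaler0 addr0.
exact: (submodule_exists (Submodule f0 fP)).
Qed.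

Lemma image_exists X Y (f : homA X Y) :
  exists (I : fgmod A) (i : homA I Y),
    injective i /\ forall y, (exists x, f x = y) <-> exists z, i z = y.
Proof.
have f0 : exists x, f x = 0 by exists 0; rewrite linear0.
have fP a y y' : (exists x, f x = y) -> (exists x, f x = y') ->
    exists x, f x = a *: y + y'.
  by move=> [x <-] [x' <-]; exists (a *: x + x'); rewrite linearP.
exact: (submodule_exists (Submodule f0 fP)).
Qed.

Lemma coker_exists X Y (f : homA X Y) :
  exists (C : fgmod A) (p : homA Y C), hsurjective p /\ exact_at f p.
Proof.
have f0 : exists x, f x = 0 by exists 0; rewrite linear0.
have fP a y y' : (exists x, f x = y) -> (exists x, f x = y') ->
    exists x, f x = a *: y + y'.
  by move=> [x <-] [x' <-]; exists (a *: x + x'); rewrite linearP.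
exact: (quotient_exists (Submodule f0 fP)).
Qed.

Lemma factor_through_inj X Y Z (i : homA Y Z) (f : homA X Z) :
  injective i -> (forall x, exists y, i y = f x) ->
  exists h : homA X Y, f = hcomp i h.
Proof.
move=> iinj /choice[h ih].
have hlin : linear h by move=> a x y; apply: iinj; rewrite linearP !ih linearP.
by exists (mkhom hlin); apply: homA_ext => x /=; rewrite ih.
Qed.

Lemma factor_through_surj X Y Z (p : homA X Y) (f : homA X Z) :
  hsurjective p -> (forall x, p x = 0 -> f x = 0) ->
  exists h : homA Y Z, f = hcomp h p.
Proof.
move=> /choice[s ps] pf.
have fE x y : p x = p y -> f x = f y.
  move=> pxy; apply/eqP; rewrite -subr_eq0 -linearB; apply/eqP/pf.
  by rewrite linearB pxy subrr.
have hlin : linear (f \o s).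
  by move=> a x y /=; rewrite -linearP; apply: fE; rewrite linearP !ps.
by exists (mkhom hlin); apply: homA_ext => x /=; apply: fE; rewrite ps.
Qed.

Lemma prod_fg X Y : finitely_generated ((X * Y)%type : lmodType A^c).
Proof.
have [m [g gs]] := fgmod_fg X; have [n [h hs]] := fgmod_fg Y.
exists (m + n)%N, (fun i => match split i with
  | inl j => (g j, 0) | inr j => (0, h j) end) => -[x y].
have [a ->] := gs x; have [b ->] := hs y.
exists (fun i => match split i with inl j => a j | inr j => b j end).
have splitl j : split (lshift n j) = inl j := unsplitK (inl j).
have splitr j : split (rshift m j) = inr j := unsplitK (inr j).
rewrite big_split_ord /=.
under [X in _ = X + _]eq_bigr do rewrite splitl.
under [X in _ = _ + X]eq_bigr do rewrite splitr.
apply/pair_eqP; apply/andP; split; apply/eqP; rewrite /= ?raddfD ?raddf_sum /=.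
  by rewrite [X in _ + X]big1 ?addr0 // => j _; apply: scaler0.
by rewrite [X in _ = X + _]big1 ?add0r // => j _; apply: scaler0.
Qed.

Definition prodm X Y : fgmod A := FgMod (prod_fg X Y).

Fact pair_linear X Y Z (f : homA X Y) (g : homA X Z) :
  linear (fun x => (f x, g x) : prodm Y Z).
Proof. by move=> a x y; rewrite !linearP. Qed.
Definition hpair X Y Z (f : homA X Y) (g : homA X Z) : homA X (prodm Y Z) :=
  mkhom (pair_linear f g).

Fact copair_linear X Y Z (f : homA X Z) (g : homA Y Z) :
  linear (fun u : prodm X Y => f u.1 + g u.2).
Proof. by move=> a u v; rewrite !linearP /= scalerDr addrACA. Qed.
Definition hcopair X Y Z (f : homA X Z) (g : homA Y Z) : homA (prodm X Y) Z :=
  mkhom (copair_linear f g).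

(** The elementwise conditions are the ones used in diagram chases; [pullback_univ] recovers the
    universal property from them. *)
Lemma pullback_exists X Y Z (f : homA X Z) (g : homA Y Z) :
  exists (P : fgmod A) (p : homA P X) (q : homA P Y),
    [/\ hcomp f p = hcomp g q,
        forall x y, f x = g y -> exists z, p z = x /\ q z = y &
        forall z, p z = 0 -> q z = 0 -> z = 0].
Proof.
have [P [i [iinj iex]]] := ker_exists (hcopair f (- g)).
have fst_lin : linear (fun z => (i z).1) by move=> a x y; rewrite linearP.
have snd_lin : linear (fun z => (i z).2) by move=> a x y; rewrite linearP.
exists P, (mkhom fst_lin), (mkhom snd_lin); split=> [|x y fg|z /= z1 z2].
- apply: homA_ext => z /=.
  have /eqP : hcopair f (- g) (i z) = 0 by apply/iex; exists z.
  by rewrite /= subr_eq0 => /eqP.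
- have /iex[z iz] : hcopair f (- g) (x, y) = 0 by rewrite /= fg subrr.
  by exists z; rewrite /= iz.
by apply: iinj; rewrite linear0 [i z]surjective_pairing z1 z2.
Qed.

Lemma pushout_exists X Y Z (f : homA Z X) (g : homA Z Y) :
  exists (P : fgmod A) (p : homA X P) (q : homA Y P),
    [/\ hcomp p f = hcomp q g,
        forall x y, p x = q y -> exists z, x = f z /\ y = g z &
        forall u, exists x y, u = p x + q y].
Proof.
have [P [c [csurj cex]]] := coker_exists (hpair f (- g)).
have inl_lin : linear (fun x : X => (x, 0) : prodm X Y).
  by move=> a x y; rewrite -[RHS]/(_, a *: 0 + 0) scaler0 addr0.
have inr_lin : linear (fun y : Y => (0, y) : prodm X Y).
  by move=> a x y; rewrite -[RHS]/(a *: 0 + 0, _) scaler0 addr0.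
exists P, (hcomp c (mkhom inl_lin)), (hcomp c (mkhom inr_lin)).
have subE x y : c (x, - y) = c (x, 0) - c (0, y).
  by rewrite -linearB; congr (c (_, _)); rewrite /= ?subr0 ?sub0r.
split=> [|x y /eqP|u].
- apply: homA_ext => z /=; apply/eqP; rewrite -subr_eq0 -subE; apply/eqP/cex.
  by exists z.
- by rewrite -subr_eq0 -subE => /eqP/cex[z [<- /oppr_inj <-]]; exists z.
have [[x y] <-] := csurj u; exists x, y; rewrite /= -linearD; congr (c (_, _)).
  by rewrite /= addr0.
by rewrite /= add0r.
Qed.

End Modules.


(** * Local endomorphism rings and decompositions *)

Section Indecomposables.
Variables (k : fieldType) (A : falgType k).
Implicit Types M N P U V W X Y Z : fgmod A.

Lemma image_factor X Y (f : homA X Y) :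
  exists (I : fgmod A) (i : homA I Y) (c : homA X I),
    [/\ injective i, hsurjective c & f = hcomp i c].
Proof.
have [I [i [iinj iim]]] := image_exists f.
have [|c fE] := factor_through_inj (f := f) iinj.
  by move=> x; apply/iim; exists x.
exists I, i, c; split=> // z.
have /iim[x fx] : exists z', i z' = i z by exists z.
by exists x; apply: iinj; rewrite -fx fE.
Qed.

Lemma surj_bij X (f : homA X X) : hsurjective f -> bijective f.
Proof.
move=> fsurj; apply: inj_bij => //; apply: inj_homP => x fx0.
have := limg_ker_dim (linfun (klin f)) fullv.
have -> : limg (linfun (klin f)) = fullv.
  apply/eqP; rewrite eqEsubv subvf; apply/subvP => y _.
  by have [z <-] := fsurj y; rewrite -linfunE; apply: memv_img; apply: memvf.
rewrite capfv -[X in _ = X]add0n => /addIn/eqP; rewrite dimv_eq0 => /eqP ker0.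
have : (x : kmod X) \in lker (linfun (klin f)).
  by rewrite memv_ker linfunE fx0.
by rewrite ker0 memv0 => /eqP.
Qed.

(** [I] is the image of a power of [e], of least possible dimension. That power restricts to an
    automorphism [c i] of [I], whose inverse turns the corestriction [c] into the projection [p]. *)
Lemma fitting X (e : homA X X) :
  exists n (I : fgmod A) (i : homA I X) (p : homA X I),
    [/\ hcomp p i = hid I, bijective (hcomp p (hcomp e i)) &
        forall x, p x = 0 -> iter n e x = 0].
Proof.
pose P d := exists n (I : fgmod A) (i : homA I X) (c : homA X I),
  [/\ injective i, hsurjective c, kdim I = d &
      forall x, iter n.+1 e x = i (c x)].
have exP : exists d, `[< P d >].
  have [I [i [c [iinj csurj eE]]]] := image_factor e.
  exists (kdim I); apply/asboolP; exists 0%N, I, i, c; split=> // x.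
  by rewrite [in LHS]eE.
case: (ex_minnP exP) => d /asboolP[n [I [i [c [iinj csurj dI en]]]]] dmin.
have ci_bij : bijective (hcomp c i).
  have [I' [i' [c' [i'inj c'surj ciE]]]] := image_factor (hcomp c i).
  have i'bij : bijective i'.
    apply: inj_bij => //; rewrite dI; apply: dmin; apply/asboolP.
    (* The successor of this exponent is twice [n.+1]: the squared power is [i (c i) c] and factors
       through the image [I'] of [c i]. *)
    exists (n + n.+1)%N, I', (hcomp i i'), (hcomp c' c); split=> //.
    - exact: inj_comp.
    - move=> z; have [y <-] := c'surj z; have [x <-] := csurj y.
      by exists x.
    - move=> x; rewrite -addSn iterD !en.
      by rewrite -[LHS]/(i (hcomp c i (c x))) ciE.
  apply: surj_bij => y; have [z <-] := bij_surj i'bij y.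
  by have [w <-] := c'surj z; exists w; rewrite ciE.
have [b [bci cib]] := hom_inv ci_bij.
have bE y : b (c (i y)) = y by rewrite -[RHS]/(hid I y) -bci.
have cbE y : c (i (b y)) = y by rewrite -[RHS]/(hid I y) -cib.
exists n.+1, I, i, (hcomp b c); split.
- by rewrite -hcompA.
(* Since [e] commutes with its powers, [c (e (i y)) = 0] puts [i (c (i y))] in the kernel of [e],
   hence of the power; cancelling the automorphism [c i] twice leaves [y = 0]. *)
- apply: inj_bij => //; apply: inj_homP => y /= /(congr1 (hcomp c i)) /=.
  rewrite cbE !linear0 => ceiy.
  have eci0 : e (i (c (i y))) = 0.
    have eS : iter n.+1 e (e (i y)) = e (iter n.+1 e (i y)) by rewrite -iterSr.
    by rewrite -en -eS en ceiy linear0.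
  have iter0 m : iter m e 0 = 0 by elim: m => //= m ->; rewrite linear0.
  have : i (c (i (c (i y)))) = 0 by rewrite -en iterSr eci0 iter0.
  by rewrite -(linear0 i) => /iinj/(congr1 b); rewrite bE linear0 => /(congr1
    b);
    rewrite bE linear0.
- by move=> x bcx; rewrite en -[c x]cbE [b (c x)]bcx !linear0.
Qed.

(** [X] is the direct sum of [I] and the kernel of [p], so one of the two vanishes. *)
Lemma section_indec X (I : fgmod A) (i : homA I X) (p : homA X I) :
  indecomposable X -> hcomp p i = hid I ->
  (forall y : I, y = 0) \/ bijective i.
Proof.
move=> [_ Xindec] pi.
have piE y : p (i y) = y by rewrite -[RHS]/(hid I y) -pi.
have [K [j [jinj jex]]] := ker_exists p.
have jK z : p (j z) = 0 by apply/jex; exists z.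
have dec x : exists z, j z = x - i (p x).
  by apply/jex; rewrite linearB piE subrr.
have [|I0|K0] := Xindec I K; [|by left|right].
- exists (hcopair i j); apply: (@inj_surj_bij _ _ (prodm I K)).
    apply: inj_homP => -[y z] /= yz0.
    have y0 : y = 0 by have := congr1 p yz0; rewrite linearD piE jK addr0
      linear0.
    move: yz0; rewrite y0 linear0 add0r -(linear0 j) => /jinj ->.
    by [].
  by move=> x; have [z jz] := dec x; exists (p x, z); rewrite /= jz addrC subrK.
exists p => // x; have [z] := dec x; rewrite [z]K0 linear0 => /esym/eqP.
by rewrite subr_eq0 => /eqP <-.
Qed.

Lemma section_indec_bij X Y (i : homA Y X) (p : homA X Y) :
  indecomposable X -> indecomposable Y -> hcomp p i = hid Y -> bijective i.
Proof.
move=> Xindec [[y y0] _] pi; have [Y0|//] := section_indec Xindec pi.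
by rewrite [y]Y0 eqxx in y0.
Qed.

Lemma hcomp_id_bij X Y (p : homA X Y) (i : homA Y X) :
  hcomp p i = hid Y -> bijective i -> bijective p.
Proof.
move=> pi /hom_inv[j [ji ij]]; apply: (@hinv_bij _ _ _ _ p i) => //.
by rewrite -[p]hcompf1 -ij [hcomp p _]hcompA pi hcomp1 ij.
Qed.

Lemma retraction_indec_bij X Y (i : homA Y X) (p : homA X Y) :
  indecomposable X -> indecomposable Y -> hcomp p i = hid Y -> bijective p.
Proof.
by move=> Xi Yi pi; apply: (hcomp_id_bij pi); apply: section_indec_bij pi.
Qed.

Lemma indec_endo X (e : homA X X) : indecomposable X ->
  bijective e \/ exists n, forall x, iter n e x = 0.
Proof.
move=> Xindec; have [n [I [i [p [pi pei en]]]]] := fitting e.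
have [I0|ibij] := section_indec Xindec pi; [right|left].
  by exists n => x; apply/en/I0.
have [j [ji ij]] := hom_inv ibij.
have jp : j = p by rewrite -[p]hcompf1 -ij hcompA pi hcomp1.
have eE : e = hcomp i (hcomp (hcomp p (hcomp e i)) j).
  by rewrite -!hcompA ij hcompf1 hcompA -jp ij hcomp1.
rewrite eE; apply: hcomp_bij => //; apply: hcomp_bij => //.
exact: (hinv_bij ij ji).
Qed.

(** An element of the kernel satisfies [e x = - x], hence is up to sign equal to its image under the
    vanishing power. *)
Lemma nilpotent_add_bij X (e : homA X X) n :
  (forall x, iter n e x = 0) -> bijective (hid X + e).
Proof.
move=> en; apply: inj_bij => //; apply: inj_homP => x /eqP.
rewrite hom_addE addr_eq0 => /eqP /= xE.
have exE : e x = - x by rewrite [in RHS]xE opprK.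
have iterE m : iter m e x = (-1) ^+ m *: x.
  elim: m => [|m IHm] /=; first by rewrite expr0 scale1r.
  by rewrite IHm linearZ /= exE scalerN -scaleNr exprS mulN1r.
have := en x; rewrite iterE => /(congr1 (fun y => (-1) ^+ n *: y)).
by rewrite scalerA -exprD addnn -signr_odd odd_double scale1r scaler0.
Qed.

(** After normalising the sum to the identity by [g], either [g e] is an automorphism or it is
    nilpotent, and then [g f = 1 - g e] is invertible. *)
Lemma indec_local X (e f : homA X X) : indecomposable X ->
  bijective (e + f) -> bijective e \/ bijective f.
Proof.
move=> Xindec efbij; have [g [gef efg]] := hom_inv efbij.
have gbij : bijective g by apply: (hinv_bij efg gef).
have [gebij|[n gen]] := indec_endo (hcomp g e) Xindec.
  left; have -> : e = hcomp (e + f) (hcomp g e) by rewrite hcompA efg hcomp1.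
  exact: hcomp_bij.
right; have -> : f = hcomp (e + f) (hcomp g f) by rewrite hcompA efg hcomp1.
apply: hcomp_bij => //.
have -> : hcomp g f = hid X + - hcomp g e by rewrite -gef hcompDr addrC addKr.
apply: (@nilpotent_add_bij _ _ n) => x.
have -> : iter n (- hcomp g e) x = (-1) ^+ n *: iter n (hcomp g e) x.
  elim: n {gen} => [|n IHn]; first by rewrite expr0 scale1r.
  rewrite !iterS IHn linearZ /= scalerN -scaleNr.
  by rewrite exprS mulN1r.
by rewrite gen scaler0.
Qed.

Lemma indec_nonbijD X (e f : homA X X) : indecomposable X ->
  ~ bijective e -> ~ bijective f -> ~ bijective (e + f).
Proof. by move=> Xindec ne nf /(indec_local Xindec)[]. Qed.

Lemma indec_nonbij_sum X I (s : seq I) (P : pred I) (e : I -> homA X X) :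
  indecomposable X -> (forall i, P i -> ~ bijective (e i)) ->
  ~ bijective (\sum_(i <- s | P i) e i).
Proof.
move=> Xindec ne; elim/big_ind: _ => //; last by move=> *; apply: indec_nonbijD.
case: (Xindec) => [[x x0] _] /bij_surj/(_ x)[y /esym].
by rewrite hom0E => xE; rewrite xE eqxx in x0.
Qed.

Lemma bij_comp_indec X Y (f : homA X Y) (g : homA Y X) :
  indecomposable X -> indecomposable Y -> bijective (hcomp g f) ->
  bijective f /\ bijective g.
Proof.
move=> Xi Yi /hom_inv[h [hgf gfh]].
have fbij : bijective f.
  by apply: (@section_indec_bij _ _ f (hcomp h g)) => //; rewrite -hcompA.
split=> //; apply: (@retraction_indec_bij _ _ (hcomp f h) g) => //.
by rewrite hcompA.
Qed.

(* This makes the ideal property immediate; [radicalE] below identifies it with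
   [radical]. *)
Definition radmor X Y (f : homA X Y) : Prop :=
  forall Z (u : homA Z X) (w : homA Y Z),
    indecomposable Z -> ~ bijective (hcomp w (hcomp f u)).

Lemma radmor_compl X Y Z (g : homA Y Z) (f : homA X Y) :
  radmor f -> radmor (hcomp g f).
Proof.
move=> fr W u w Wi; have := fr W u (hcomp w g) Wi.
by rewrite !hcompA.
Qed.

Lemma radmor_compr X Y Z (g : homA Y Z) (f : homA X Y) :
  radmor g -> radmor (hcomp g f).
Proof.
move=> gr W u w Wi; have := gr W (hcomp f u) w Wi.
by rewrite !hcompA.
Qed.

Lemma radmorD X Y (f g : homA X Y) : radmor f -> radmor g -> radmor (f + g).
Proof.
move=> fr gr Z u w Zi; rewrite hcompDl hcompDr.
by apply: indec_nonbijD => //; [apply: fr|apply: gr].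
Qed.

Lemma radmor0 X Y : radmor (0 : homA X Y).
Proof.
move=> Z u w Zi; rewrite hcomp0 hcompf0.
by have := @indec_nonbij_sum Z void [::] predT (fun _ => 0) Zi; rewrite
  big_nil; apply.
Qed.

Lemma radmorZ X Y c (f : homA X Y) : radmor f -> radmor (c *: f).
Proof.
move=> fr; rewrite -[f]hcompf1 -hcompZr; exact: radmor_compr.
Qed.

Lemma radmor_sum X Y I (s : seq I) (P : pred I) (f : I -> homA X Y) :
  (forall i, P i -> radmor (f i)) -> radmor (\sum_(i <- s | P i) f i).
Proof.
by move=> fr; elim/big_ind: _ => //; [apply: radmor0|apply: radmorD].
Qed.

(** If [w f u] is an automorphism of an indecomposable [Z], then [u] is an isomorphism from [Z] to
    the indecomposable [X], and transporting along it gives a left inverse of [f]. *)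
Lemma radmor_section X Y (f : homA X Y) :
  indecomposable X -> radmor f <-> ~ section_mor f.
Proof.
move=> Xi; split=> [fr [g gf]|fns Z u w Zi].
  by apply: (fr X (hid X) g Xi); rewrite hcompf1 gf; apply: hid_bij.
rewrite hcompA => wfu; have [ubij wfbij] := bij_comp_indec Zi Xi wfu.
have [u' [u'u uu']] := hom_inv ubij; have [h [hwfu _]] := hom_inv wfu.
apply: fns; exists (hcomp u (hcomp h w)).
have -> : hcomp (hcomp u (hcomp h w)) f =
  hcomp u (hcomp (hcomp h (hcomp (hcomp w f) u)) u').
  by rewrite -!hcompA uu' hcompf1.
by rewrite hwfu hcomp1.
Qed.

Lemma radmor_retraction X Y (f : homA X Y) :
  indecomposable Y -> radmor f <-> ~ retraction_mor f.
Proof.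
move=> Yi; split=> [fr [g fg]|fns Z u w Zi].
  by apply: (fr Y g (hid Y) Yi); rewrite hcomp1 fg; apply: hid_bij.
move=> wfu; have [fubij wbij] := bij_comp_indec Zi Yi wfu.
have [w' [w'w ww']] := hom_inv wbij; have [h [_ wfuh]] := hom_inv wfu.
apply: fns; exists (hcomp u (hcomp h w)).
have -> : hcomp f (hcomp u (hcomp h w)) =
  hcomp w' (hcomp (hcomp (hcomp w (hcomp f u)) h) w).
  by rewrite !hcompA w'w hcomp1.
by rewrite wfuh hcomp1.
Qed.

Lemma radmor_indec X Y (f : homA X Y) :
  indecomposable X -> indecomposable Y -> radmor f <-> ~ bijective f.
Proof.
move=> Xi Yi; rewrite radmor_section //; split=> nf fP; apply: nf.
  by have [g [gf _]] := hom_inv fP; exists g.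
by case: fP => g gf; apply: section_indec_bij gf.
Qed.

Lemma indec_id_nonrad X : indecomposable X -> ~ radmor (hid X).
Proof. by move=> Xi /radmor_indec; apply => //; apply: hid_bij. Qed.

(** Induction on the dimension: a proper summand is smaller, as its inclusion cannot be surjective
    when the complement is nonzero. *)
Lemma indec_decomposition X : exists (I : finType) (U : I -> fgmod A)
    (u : forall i, homA (U i) X) (v : forall i, homA X (U i)),
  [/\ forall i, indecomposable (U i), forall i, hcomp (v i) (u i) = hid (U i),
      forall i j, i != j -> hcomp (v j) (u i) = 0 &
      \sum_i hcomp (u i) (v i) = hid X].
Proof.
have [n] := ubnP (kdim X); elim: n X => // n IHn X ltXn.
have [X0|Xn0] := EM (forall x : X, x = 0).
  exists void, (fun i : void => match i with end), (fun i : void => match i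
    with end).
  exists (fun i : void => match i with end); split=> [[]|[]|[]|].
  by apply: homA_ext => x; rewrite [RHS]X0 [LHS]X0.
have [Xi|nXi] := EM (indecomposable X).
  exists unit, (fun=> X), (fun=> hid X), (fun=> hid X).
  split; [by []|by move=> _; apply: hcomp1|by case; case|].
  by rewrite (big_pred1 tt) ?hcomp1 // => -[].
have [U [V [f [fbij [Un0 Vn0]]]]] : exists U V (f : homA (prodm U V) X),
    bijective f /\ ~ (forall u : U, u = 0) /\ ~ (forall v : V, v = 0).
  apply: contrapT => nUV; apply: nXi; split.
    apply: contrapT => nx; apply: Xn0 => x; apply/eqP/negPn/negP => x0.
    by apply: nx; exists x.
  move=> U V [f fbij]; apply: contrapT => /not_orP[Un0 Vn0].
  by apply: nUV; exists U, V, f.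
have inl_lin : linear (fun x : U => (x, 0) : prodm U V).
  by move=> a x y; rewrite -[RHS]/(_, a *: 0 + 0) scaler0 addr0.
have inr_lin : linear (fun y : V => (0, y) : prodm U V).
  by move=> a x y; rewrite -[RHS]/(a *: 0 + 0, _) scaler0 addr0.
have fst_lin : linear (fun z : prodm U V => z.1) by [].
have snd_lin : linear (fun z : prodm U V => z.2) by [].
have [g [gf fg]] := hom_inv fbij.
pose a := hcomp f (mkhom inl_lin); pose b := hcomp f (mkhom inr_lin).
pose a' := hcomp (mkhom fst_lin : homA (prodm U V) U) g.
pose b' := hcomp (mkhom snd_lin : homA (prodm U V) V) g.
have gfE z : g (f z) = z by rewrite -[RHS]/(hid (prodm U V) z) -gf.
have a'a : hcomp a' a = hid U by apply: homA_ext => x /=; rewrite gfE.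
have b'b : hcomp b' b = hid V by apply: homA_ext => x /=; rewrite gfE.
have a'b : hcomp a' b = 0 by apply: homA_ext => x /=; rewrite gfE.
have b'a : hcomp b' a = 0 by apply: homA_ext => x /=; rewrite gfE.
have ab1 : hcomp a a' + hcomp b b' = hid X.
  rewrite -fg; apply: homA_ext => x; rewrite hom_addE /= -linearD.
  congr (f _); rewrite [RHS]surjective_pairing; congr (_, _); rewrite /=.
    by rewrite addr0.
  by rewrite add0r.
have ltU : (kdim U < n)%N.
  apply: (@leq_trans (kdim X)); last by rewrite -ltnS.
  apply: (@inj_nonsurj_kdim _ _ _ _ a).
    by apply: section_inj; exists a'.
  move=> asurj; apply: Vn0 => v; have [x xE] := asurj (b v).
  have := congr1 (fun h : homA V V => h v) b'b; rewrite /= -/b'.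
  rewrite -[LHS]/(b' (b v)) -xE -[LHS]/(hcomp b' a x) b'a.
  by move=> <-.
have ltV : (kdim V < n)%N.
  apply: (@leq_trans (kdim X)); last by rewrite -ltnS.
  apply: (@inj_nonsurj_kdim _ _ _ _ b).
    by apply: section_inj; exists b'.
  move=> bsurj; apply: Un0 => v; have [x xE] := bsurj (a v).
  have := congr1 (fun h : homA U U => h v) a'a.
  rewrite -[LHS]/(a' (a v)) -xE -[LHS]/(hcomp a' b x) a'b.
  by move=> /= <-.
have [I1 [U1 [u1 [v1 [ind1 id1 ort1 sum1]]]]] := IHn U ltU.
have [I2 [U2 [u2 [v2 [ind2 id2 ort2 sum2]]]]] := IHn V ltV.
pose UV (s : I1 + I2) := match s with inl i => U1 i | inr i => U2 i end.
exists (I1 + I2)%type, UV.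
exists (fun s => match s return homA (UV s) X with
  | inl i => hcomp a (u1 i) | inr i => hcomp b (u2 i) end).
exists (fun s => match s return homA X (UV s) with
  | inl i => hcomp (v1 i) a' | inr i => hcomp (v2 i) b' end).
have cE (W1 W2 W3 W4 W5 : fgmod A) (v : homA W4 W5) (a1 : homA W3 W4)
    (a2 : homA W2 W3) (u : homA W1 W2) :
    hcomp (hcomp v a1) (hcomp a2 u) = hcomp v (hcomp (hcomp a1 a2) u).
  exact: homA_ext.
split=> [[]//|[] i|[] i [] j ij|].
- by rewrite cE a'a hcomp1 id1.
- by rewrite cE b'b hcomp1 id2.
- by rewrite cE a'a hcomp1 ort1.
- by rewrite cE b'a hcomp0 hcompf0.
- by rewrite cE a'b hcomp0 hcompf0.
- by rewrite cE b'b hcomp1 ort2.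
rewrite big_sumType /=.
under eq_bigr do rewrite cE.
under [X in _ + X]eq_bigr do rewrite cE.
by rewrite -!hcomp_sumr -!hcomp_suml sum1 sum2 !hcomp1.
Qed.

End Indecomposables.


(** * The radical and its square *)

(** Independence of [b] makes the product of the two base change matrices the identity. They are
    square, so they are also inverse in the other order, and this recovers [c] from [c N = 0]. *)
Lemma independent_of_basis (k : fieldType) (V : lmodType k) n (b f : 'I_n -> V)
  :
  (forall i, exists c : 'I_n -> k, b i = \sum_j c j *: f j) ->
  (forall j, exists c : 'I_n -> k, f j = \sum_i c i *: b i) ->
  (forall c : 'I_n -> k, \sum_i c i *: b i = 0 -> forall i, c i = 0) ->
  forall c : 'I_n -> k, \sum_j c j *: f j = 0 -> forall j, c j = 0.
Proof.
move=> /choice[M bM] /choice[N fN] bfree c cf0 j.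
pose MM := \matrix_(i, j) M i j; pose NN := \matrix_(i, j) N i j.
have MN : MM *m NN = 1%:M.
  apply/matrixP => i l; apply/eqP; rewrite -subr_eq0; apply/eqP.
  move: l; apply: bfree.
  under eq_bigr do rewrite scalerBl.
  rewrite sumrB [X in _ - X](bigD1 i) //= mxE eqxx scale1r.
  rewrite [X in _ - (_ + X)]big1 => [|l li]; last first.
    by rewrite mxE eq_sym (negPf li) scale0r.
  rewrite addr0 [X in _ - X]bM; apply/eqP; rewrite subr_eq0; apply/eqP.
  under [RHS]eq_bigr do rewrite fN scaler_sumr.
  rewrite exchange_big; apply: eq_bigr => l _; rewrite mxE scaler_suml.
  by apply: eq_bigr => m _; rewrite !mxE scalerA.
have cN : (\row_j c j) *m NN = 0.
  apply/rowP => i; rewrite [RHS]mxE; move: i; apply: bfree.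
  rewrite -[RHS]cf0; under [RHS]eq_bigr do rewrite fN scaler_sumr.
  rewrite exchange_big; apply: eq_bigr => l _; rewrite mxE scaler_suml.
  by apply: eq_bigr => m _; rewrite !mxE scalerA.
have : (\row_j c j) *m NN *m MM = 0 by rewrite cN mul0mx.
rewrite -mulmxA (mulmx1C MN) mulmx1 => /rowP/(_ j).
by rewrite !mxE.
Qed.

Section Radical.
Variables (k : fieldType) (A : falgType k).
Implicit Types M N P U V W X Y Z : fgmod A.

Section Matrices.
Variables (I : finType) (U : I -> fgmod A).

Lemma dproj_dinj i : hcomp (dproj U i) (dinj U i) = hid (U i).
Proof. by apply: homA_ext => x; rewrite /= /dinj_fun dfwith_in. Qed.

Lemma sum_dinj_dproj : \sum_i hcomp (dinj U i) (dproj U i) = hid (dsum U).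
Proof.
by apply: homA_ext => x; rewrite hom_sumE [RHS](dsum_decomp x).
Qed.

Lemma hrow_dinj Y (f : forall i, homA (U i) Y) i :
  hcomp (hrow f) (dinj U i) = f i.
Proof.
apply: homA_ext => x /=; rewrite (bigD1 i) //= /dinj_fun dfwith_in.
rewrite big1 ?addr0 // => j ji; rewrite dfwith_out ?linear0 // eq_sym //.
Qed.

Lemma dproj_hcol Y (f : forall i, homA Y (U i)) i :
  hcomp (dproj U i) (hcol f) = f i.
Proof. by apply: homA_ext => x. Qed.

Lemma hrowE Y (f : forall i, homA (U i) Y) :
  hrow f = \sum_i hcomp (f i) (dproj U i).
Proof. by apply: homA_ext => x; rewrite hom_sumE. Qed.

Lemma hcolE Y (f : forall i, homA Y (U i)) :
  hcol f = \sum_i hcomp (dinj U i) (f i).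
Proof.
rewrite -[LHS]hcomp1 -sum_dinj_dproj hcomp_suml; apply: eq_bigr => i _.
by rewrite -hcompA dproj_hcol.
Qed.

Lemma hrow_comp X Y (f : forall i, homA (U i) Y) (u : homA X (dsum U)) :
  hcomp (hrow f) u = \sum_i hcomp (f i) (hcomp (dproj U i) u).
Proof.
by rewrite hrowE hcomp_suml; apply: eq_bigr => i _; rewrite hcompA.
Qed.

Lemma hcol_comp X Y (f : forall i, homA Y (U i)) (u : homA (dsum U) X) :
  hcomp u (hcol f) = \sum_i hcomp (hcomp u (dinj U i)) (f i).
Proof.
by rewrite hcolE hcomp_sumr; apply: eq_bigr => i _; rewrite hcompA.
Qed.

Lemma hrow_hcol X Y (f : forall i, homA (U i) Y) (g : forall i, homA X (U i)) :
  hcomp (hrow f) (hcol g) = \sum_i hcomp (f i) (g i).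
Proof. by rewrite hrow_comp; apply: eq_bigr => i _; rewrite dproj_hcol. Qed.

Lemma radmor_hrow Y (f : forall i, homA (U i) Y) :
  (forall i, radmor (f i)) -> radmor (hrow f).
Proof. by move=> fr; rewrite hrowE; apply: radmor_sum => i _; apply:
  radmor_compr. Qed.

Lemma radmor_hcol Y (f : forall i, homA Y (U i)) :
  (forall i, radmor (f i)) -> radmor (hcol f).
Proof. by move=> fr; rewrite hcolE; apply: radmor_sum => i _; apply:
  radmor_compl. Qed.

End Matrices.

Lemma radmor_entries (I J : finType) (U : I -> fgmod A) (V : J -> fgmod A)
    (f : homA (dsum U) (dsum V)) :
  (forall i j, radmor (hcomp (dproj V j) (hcomp f (dinj U i)))) -> radmor f.
Proof.
move=> fr; rewrite -[f]hcomp1 -[f]hcompf1 -!sum_dinj_dproj.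
rewrite hcomp_suml; apply: radmor_sum => j _.
rewrite !hcomp_sumr; apply: radmor_sum => i _.
rewrite -hcompA; apply: radmor_compl.
by rewrite !hcompA; apply: radmor_compr; rewrite -hcompA.
Qed.

Lemma indec_decomposition_ord X :
  exists (n : nat) (U : 'I_n -> fgmod A) (p : homA (dsum U) X) (q : homA X
    (dsum U)),
    [/\ forall i, indecomposable (U i), hcomp p q = hid X &
        hcomp q p = hid (dsum U)].
Proof.
have [n [U [u [v [Ui vu vu0 uv]]]]] : exists n (U : 'I_n -> fgmod A)
    (u : forall i, homA (U i) X) (v : forall i, homA X (U i)),
  [/\ forall i, indecomposable (U i), forall i, hcomp (v i) (u i) = hid (U i),
      forall i j, i != j -> hcomp (v j) (u i) = 0 &
      \sum_i hcomp (u i) (v i) = hid X].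
  have [I [U [u [v [Ui vu vu0 uv]]]]] := indec_decomposition X.
  have [e ebij] : exists e : 'I_#|I| -> I, bijective e.
    by exists enum_val; apply: enum_val_bij.
  exists #|I|, (fun i => U (e i)), (fun i => u (e i)), (fun i => v (e i)).
  split=> // [i j ij|]; last by rewrite -uv (reindex e) //; apply: onW_bij.
  by apply: vu0; apply: contra ij => /eqP/(bij_inj ebij) ->.
exists n, U, (hrow u), (hcol v); split=> //; first by rewrite hrow_hcol.
rewrite -[LHS]hcompf1 -sum_dinj_dproj hcomp_sumr; apply: eq_bigr => i _.
rewrite hcompA; congr (hcomp _ _); rewrite -hcompA hrow_dinj.
rewrite hcolE hcomp_suml (bigD1 i) // -hcompA vu hcompf1 big1 => [|j ji].
  exact: addr0.
by rewrite -hcompA vu0 ?hcompf0 // eq_sym.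
Qed.

(** In particular the condition in [radical] does not depend on the decompositions chosen there. *)
Lemma radicalE X Y (f : homA X Y) : radical f <-> radmor f.
Proof.
split=> [[m [n [U [V [p [q [Ui Vi /hom_inv[p' [p'p pp']] /hom_inv[q' [q'q qq']]
  fn]]]]]]]|fr].
  have -> : f = hcomp q' (hcomp (hcomp q (hcomp f p)) p').
    by rewrite !hcompA q'q hcomp1 -hcompA pp' hcompf1.
  apply: radmor_compl; apply: radmor_compr; apply: radmor_entries => i j.
  by rewrite radmor_indec // -hcompA -[hcomp (hcomp f p) _]hcompA.
have [m [U [p [p' [Ui pp' p'p]]]]] := indec_decomposition_ord X.
have [n [V [q [q' [Vi qq' q'q]]]]] := indec_decomposition_ord Y.
exists m, n, U, V, p, q'; split=> //.
- exact: (hinv_bij p'p pp').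
- exact: (hinv_bij qq' q'q).
by move=> i j; apply/radmor_indec => //; do 2!apply: radmor_compl; apply:
  radmor_compr.
Qed.

(** A sum of composites is the single composite of a column and a row through the direct sum. *)
Lemma radical2E X Y (f : homA X Y) : radical2 f <->
  exists Z (g : homA X Z) (h : homA Z Y), [/\ radmor g, radmor h & f = hcomp h
    g].
Proof.
split=> [[n [Z [g [h [gr hr ->]]]]]|[Z [g [h [gr hr ->]]]]].
  exists (dsum Z), (hcol g), (hrow h); split; last by rewrite hrow_hcol.
    by apply: radmor_hcol => i; apply/radicalE.
  by apply: radmor_hrow => i; apply/radicalE.
exists 1%N, (fun=> Z), (fun=> g), (fun=> h).
by split=> [_|_|]; [apply/radicalE|apply/radicalE|rewrite big_ord1].
Qed.

Lemma radical2_comp X Y Z (g : homA X Z) (h : homA Z Y) :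
  radmor g -> radmor h -> radical2 (hcomp h g).
Proof. by move=> gr hr; apply/radical2E; exists Z, g, h. Qed.

Lemma radical2_0 X Y : radical2 (0 : homA X Y).
Proof. by rewrite -(hcomp0 _ (0 : homA X X)); apply: radical2_comp; apply:
  radmor0. Qed.

Lemma radical2P X Y c (f f' : homA X Y) :
  radical2 f -> radical2 f' -> radical2 (c *: f + f').
Proof.
move=> /radical2E[Z [g [h [gr hr ->]]]] /radical2E[Z' [g' [h' [gr' hr' ->]]]].
pose T (b : bool) := if b then Z else Z'.
pose G b : homA X (T b) :=
  match b return homA X (T b) with true => g | false => g' end.
pose H b : homA (T b) Y :=
  match b return homA (T b) Y with true => c *: h | false => h' end.
have -> : c *: hcomp h g + hcomp h' g' = hcomp (hrow H) (hcol G).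
  by rewrite hrow_hcol big_bool /= hcompZl.
apply: radical2_comp; first by apply: radmor_hcol => -[].
by apply: radmor_hrow => -[] //=; apply: radmorZ.
Qed.

Lemma radical2D X Y (f g : homA X Y) : radical2 f -> radical2 g -> radical2 (f
  + g).
Proof. by move=> fr gr; rewrite -[f]scale1r; apply: radical2P. Qed.

Lemma radical2_sum X Y I (s : seq I) (P : pred I) (f : I -> homA X Y) :
  (forall i, P i -> radical2 (f i)) -> radical2 (\sum_(i <- s | P i) f i).
Proof.
by move=> fr; elim/big_ind: _ => //; [apply: radical2_0|apply: radical2D].
Qed.

Definition radical2_submodule X Y : submodule (homA X Y : lmodType k) :=
  Submodule (@radical2_0 X Y) (@radical2P X Y).

(** Such an [r] is nilpotent: on its Fitting part [r] is invertible, so the identity of an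
    indecomposable summand of that part would factor through [r]. *)
Lemma radmor_add_bij X (r : homA X X) : radmor r -> bijective (hid X + r).
Proof.
move=> rr; have [n [I [i [p [pi /hom_inv[b [bpri _]] rn]]]]] := fitting r.
suff I0 : forall y : I, y = 0 by apply: (@nilpotent_add_bij _ _ _ _ n) => x;
  apply/rn/I0.
have [J [U [u [v [Ui vu _ uv]]]]] := indec_decomposition I.
move=> y; rewrite -[LHS]/(hid I y) -uv big1 // => j _.
case: (rr (U j) (hcomp i (u j)) (hcomp (v j) (hcomp b p)) (Ui j)).
have -> : hcomp (hcomp (v j) (hcomp b p)) (hcomp r (hcomp i (u j))) =
  hcomp (v j) (hcomp (hcomp b (hcomp p (hcomp r i))) (u j)) by exact: homA_ext.
by rewrite bpri hcomp1 vu; apply: hid_bij.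
Qed.

(** A spanning family with as many members as the dimension is a basis. The comparison takes place
    in the whole Hom space modulo the square of the radical, which contains the classes of [b] and
    of [f]. *)
Lemma rad_quotient_free X Y n (f : 'I_n -> homA X Y) :
  rad_quotient_dim X Y n -> (forall i, radmor (f i)) ->
  (forall u, radmor u ->
     exists c : 'I_n -> k, radical2 (u - \sum_i c i *: f i)) ->
  forall c : 'I_n -> k, radical2 (\sum_i c i *: f i) -> forall i, c i = 0.
Proof.
move=> [b [br bspan bfree]] fr fspan.
pose S := radical2_submodule X Y.
pose cl := quo_class S; have cl_lin : linear cl := quo_class_linear S.
pose l : {linear (homA X Y : lmodType k) -> quo_car S} :=
  HB.pack cl (GRing.isLinear.Build k _ _ *:%R cl cl_lin).
have lP x : l x = 0 <-> radical2 x.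
  rewrite -(linear0 l); split=> [/quo_class_eqP|rx]; first by rewrite subr0.
  by apply/quo_class_eqP; rewrite subr0.
have l_sum (c : 'I_n -> k) (g : 'I_n -> homA X Y) :
    l (\sum_i c i *: g i) = \sum_i c i *: l (g i).
  by rewrite linear_sum; apply: eq_bigr => i _; rewrite linearZ.
move=> c /lP; rewrite l_sum; move: c.
apply: (@independent_of_basis _ _ _ (fun i => l (b i))) => [i|j|c].
- have [c /lP] := fspan _ ((radicalE _).1 (br i)).
  by rewrite linearB l_sum => /eqP; rewrite subr_eq0 => /eqP E; exists c.
- have [c /lP] := bspan _ ((radicalE _).2 (fr j)).
  by rewrite linearB l_sum => /eqP; rewrite subr_eq0 => /eqP E; exists c.
- by rewrite -l_sum => /lP; apply: bfree.
Qed.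

End Radical.

Import VectorInternalTheory.

(** Take for [c] an eigenvalue of [e] on the underlying vector space. *)
Lemma indec_scalar (k : closedFieldType) (A : falgType k) (X : fgmod A)
    (e : homA X X) :
  indecomposable X -> exists c : k, ~ bijective (e - c *: hid X).
Proof.
move=> [[x x0] _].
pose F := f2mx (linfun (klin e)).
have [c Fc] : exists c, root (char_poly F) c.
  apply/closed_rootP; rewrite size_char_poly eqSS.
  (* The characteristic polynomial is nonconstant because [x] is a nonzero vector. *)
  apply: contraNneq x0 => d0; rewrite -[x](@v2rK _ (kmod X)).
  rewrite [v2r _](_ : _ = 0) ?linear0 //.
  by apply/rowP => i; move: (ltn_ord i); rewrite [X in (_ < X)%N]d0.
exists c => /bij_inj einj.
move: Fc; rewrite -eigenvalue_root_char => /eigenvalueP[v vF v0].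
have ev : e (r2v v : kmod X) = c *: (r2v v : kmod X).
  rewrite -linfunE unlock /= r2vK -/F vF linearZ //.
move/negP: v0; apply; apply/eqP/(can_inj (@r2vK _ (kmod X))).
rewrite linear0; apply: einj; rewrite linear0 hom_addE hom_oppE hom_scaleE ev
  /=.
by rewrite kmodZ subrr.
Qed.


(** * Almost split maps and sequences *)

Section AlmostSplit.
Variables (k : fieldType) (A : falgType k).
Implicit Types M N P U V W X Y Z E T : fgmod A.

Lemma pullback_univ X Y Z P W (f : homA X Z) (g : homA Y Z)
    (p : homA P X) (q : homA P Y) (a : homA W X) (b : homA W Y) :
  (forall x y, f x = g y -> exists z, p z = x /\ q z = y) ->
  (forall z, p z = 0 -> q z = 0 -> z = 0) ->
  hcomp f a = hcomp g b -> exists c, hcomp p c = a /\ hcomp q c = b.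
Proof.
move=> pqex pq0 fagb.
have pqw w : exists z, p z = a w /\ q z = b w.
  by apply: pqex; rewrite -[LHS]/(hcomp f a w) fagb.
have [c pqc] := choice pqw.
have pc w : p (c w) = a w by have [] := pqc w.
have qc w : q (c w) = b w by have [] := pqc w.
have clin : linear c.
  move=> t x y; apply/eqP; rewrite -subr_eq0; apply/eqP; apply: pq0.
    by rewrite linearB linearP !pc linearP subrr.
  by rewrite linearB linearP !qc linearP subrr.
by exists (mkhom clin); split; apply: homA_ext => w /=.
Qed.

Lemma pushout_univ X Y Z P W (f : homA Z X) (g : homA Z Y)
    (p : homA X P) (q : homA Y P) (a : homA X W) (b : homA Y W) :
  (forall x y, p x = q y -> exists z, x = f z /\ y = g z) ->
  (forall u, exists x y, u = p x + q y) ->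
  hcomp a f = hcomp b g -> exists c, hcomp c p = a /\ hcomp c q = b.
Proof.
move=> pqex pqs afbg.
have csurj : hsurjective (hcopair p q).
  by move=> u; have [x [y ->]] := pqs u; exists (x, y).
have [[x y] /= /eqP|c cE] := factor_through_surj (f := hcopair a b) csurj.
  rewrite addr_eq0 -linearN => /eqP/pqex[z [-> /eqP]].
  rewrite eqr_oppLR => /eqP ->.
  by rewrite linearN -[a _]/(hcomp a f z) afbg subrr.
exists c; split; apply: homA_ext => x.
  have := congr1 (fun h : homA (prodm X Y) W => h (x, 0)) cE.
  by rewrite /= !linear0 !addr0.
have := congr1 (fun h : homA (prodm X Y) W => h (0, x)) cE.
by rewrite /= !linear0 !add0r.
Qed.

Lemma las_nonsection X Y (f : homA X Y) : left_almost_split f ->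
  forall U (u : homA X U), ~ section_mor u -> exists u', u = hcomp u' f.
Proof. by move=> [_ Xi fl] U u un; apply/fl/radicalE/radmor_section. Qed.

Lemma ras_nonretraction X Y (f : homA X Y) : right_almost_split f ->
  forall U (u : homA U Y), ~ retraction_mor u -> exists u', u = hcomp f u'.
Proof. by move=> [_ Yi fl] U u un; apply/fl/radicalE/radmor_retraction. Qed.

(** If [g] is not a section it is [u f] for some [u]; then [h u] fixes [f], and minimality makes it
    invertible. *)
Lemma lmas_factor X Y Z (f : homA X Y) (g : homA X Z) (h : homA Z Y) :
  left_almost_split f -> left_minimal f -> f = hcomp h g ->
  section_mor g \/ retraction_mor h.
Proof.
move=> fl fm fhg; have [sg|nsg] := EM (section_mor g); [by left|right].
have [u gu] := las_nonsection fl nsg.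
have /hom_inv[b [_ hub]] : bijective (hcomp h u) by apply: fm; rewrite -hcompA
  -gu.
by exists (hcomp u b); rewrite hcompA.
Qed.

Lemma rmas_factor X Y Z (f : homA X Y) (g : homA X Z) (h : homA Z Y) :
  right_almost_split f -> right_minimal f -> f = hcomp h g ->
  section_mor g \/ retraction_mor h.
Proof.
move=> fr fm fhg; have [rh|nrh] := EM (retraction_mor h); [by right|left].
have [u hu] := ras_nonretraction fr nrh.
have /hom_inv[b [bug _]] : bijective (hcomp u g) by apply: fm; rewrite hcompA
  -hu.
by exists (hcomp b u); rewrite -hcompA.
Qed.

(** If [f i] lay in the square of the radical, it would be the row composed with a radical [r].
    Replacing the column [i] of the identity matrix by [r] gives an [e] that fixes the row and so is
    invertible by minimality, although one of its columns is radical. *)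
Lemma rmas_row_not_rad2 (I : finType) (U : I -> fgmod A) X
    (f : forall i, homA (U i) X) i :
  (forall i, indecomposable (U i)) ->
  right_almost_split (hrow f) -> right_minimal (hrow f) -> ~ radical2 (f i).
Proof.
move=> Ui [_ _ fr] fm /radical2E[Z [g [h [gr /radicalE hr fhg]]]].
have [u hu] := fr Z h hr.
have [r rr fir] : exists2 r, radmor r & hcomp (hrow f) r = f i.
  by exists (hcomp u g); [apply: radmor_compl | rewrite hcompA -hu].
pose e := hid (dsum U) - hcomp (dinj U i) (dproj U i) + hcomp r (dproj U i).
have /fm/hom_inv[b [be _]] : hcomp (hrow f) e = hrow f.
  by rewrite /e !hcompDr hcompNr !hcompA hrow_dinj fir hcompf1 subrK.
have er : hcomp e (dinj U i) = r.
  by rewrite /e !hcompDl hcompNl -!hcompA dproj_dinj !hcompf1 hcomp1 subrr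
    add0r.
apply: (@indec_id_nonrad _ _ _ (Ui i)).
rewrite -(dproj_dinj U i) -[dinj U i]hcomp1 -be -hcompA er hcompA.
exact: radmor_compl.
Qed.

(** * Projective modules through dual bases, and minimal almost split maps *)

Definition regm : fgmod A.
Proof.
apply: (@FgMod _ _ (regA A)); exists 1%N, (fun=> 1) => x; exists (fun=> x).
by rewrite big_ord1 -[RHS]/(@GRing.mul A 1 x) mul1r.
Defined.

Fact scalar_hom_linear M (m : M) : linear (fun a : regA A => (a : A^c) *: m).
Proof. by move=> a x y; rewrite scalerDl scalerA. Qed.
Definition scalar_hom M (m : M) : homA regm M := mkhom (scalar_hom_linear m).

(** Equivalent to projectivity by [projectiveE]; unlike the lifting property it allows maps out of
    [P] to be expanded in coordinates, as in [hom_expand]. *)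
Definition has_dual_basis P : Prop :=
  exists n (e : 'I_n -> P) (h : 'I_n -> homA P (regA A)),
    forall x, x = \sum_i (h i x : A^c) *: e i.

Lemma dual_basis_lift P M N (g : homA M N) (f : homA P N) :
  has_dual_basis P -> (forall x, exists y, g y = f x) ->
  exists h : homA P M, f = hcomp g h.
Proof.
move=> [n [e [h eh]]] gf; have [m gm] := choice (fun i => gf (e i)).
exists (\sum_i hcomp (scalar_hom (m i)) (h i)); apply: homA_ext => x /=.
rewrite hom_sumE linear_sum [in LHS](eh x) linear_sum; apply: eq_bigr => i _.
by rewrite /= !linearZ gm.
Qed.

Definition freem n : fgmod A := dsum (fun _ : 'I_n => regm).

Lemma free_dual_basis n : has_dual_basis (freem n).
Proof.
exists n, (fun i => dinj (fun=> regm) i (1 : A)), (fun i => dproj (fun=> regm)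
  i) => x.
rewrite [LHS](dsum_decomp x); apply: eq_bigr => i _.
rewrite -linearZ; congr (dinj_fun _).
by rewrite -[RHS]/(@GRing.mul A 1 _) mul1r.
Qed.

Lemma dual_basis_retract P X (p : homA P X) :
  has_dual_basis P -> retraction_mor p -> has_dual_basis X.
Proof.
move=> [n [e [h eh]]] [s ps].
exists n, (fun i => p (e i)), (fun i => hcomp (h i) s) => x.
rewrite -[LHS]/(hid X x) -ps /= [in LHS](eh (s x)) linear_sum.
by apply: eq_bigr => i _; rewrite linearZ.
Qed.

Lemma free_cover X : exists n (q : homA (freem n) X), hsurjective q.
Proof.
have [n [g gs]] := fgmod_fg X.
exists n, (hrow (fun i => scalar_hom (g i))) => x.
by have [a ->] := gs x; exists a.
Qed.

Lemma projectiveE P : projective_module P <-> has_dual_basis P.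
Proof.
split=> [Pp|Pd M N g f gsurj]; last by apply: dual_basis_lift => // x; apply:
  gsurj.
have [n [q qs]] := free_cover P; have [s qs1] := Pp _ _ q (hid P) qs.
by apply: (dual_basis_retract (free_dual_basis n)); exists s; rewrite qs1.
Qed.

(** A free cover of a non-projective module is not a retraction, so it factors through [g]. *)
Lemma ras_surj E X (g : homA E X) :
  ~ projective_module X -> right_almost_split g -> hsurjective g.
Proof.
move=> Xnp gr x; have [n [q qs]] := free_cover X.
have [|u qgu] := ras_nonretraction gr (u := q).
  by move=> qr; apply/Xnp/projectiveE/(dual_basis_retract (free_dual_basis n)
    qr).
by have [y <-] := qs x; exists (u y); rewrite qgu.
Qed.

(** Injective envelopes are avoided: a map [f0] that does not extend along a monomorphism [g]
    yields, by pushout, a monomorphism out of [X] that is not a section, and it factors through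
    [f]. *)
Lemma las_inj X E (f : homA X E) :
  ~ injective_module X -> left_almost_split f -> injective f.
Proof.
move=> Xni fl.
have [M [N [g [f0 [ginj nh]]]]] : exists M N (g : homA M N) (f0 : homA M X),
    injective g /\ ~ exists h : homA N X, f0 = hcomp h g.
  apply: contrapT => nM; apply: Xni => M N g f0 ginj; apply: contrapT => nh.
  by apply: nM; exists M, N, g, f0.
have [P [p [q [pf pq _]]]] := pushout_exists f0 g.
have pinj : injective p.
  apply: inj_homP => x px0; have [|z [-> /esym gz0]] := pq x 0.
    by rewrite px0 linear0.
  by move: gz0; rewrite -(linear0 g) => /ginj ->; rewrite linear0.
have [|u pu] := las_nonsection fl (u := p).
  by move=> [r rp]; apply: nh; exists (hcomp r q); rewrite -hcompA -pf hcompA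
    rp hcomp1.
by move=> x y fxy; apply: pinj; rewrite pu /= fxy.
Qed.

(** With [f'] the corestriction of [f] to the kernel [K] of [g] and [r] its retraction, the
    complement to be excluded is [Z], the kernel of [r]. The test object is [Q], the quotient of [E]
    by [Z], through which [g] factors as [g' q]. *)
Lemma mas_exact T E X (f : homA T E) (g : homA E X) :
  left_almost_split f -> left_minimal f ->
  right_almost_split g -> right_minimal g ->
  hsurjective g -> hcomp g f = 0 -> exact_at f g.
Proof.
move=> fl fm gr gm gsurj gf0.
have [/radicalE frad Ti _] := fl; have [_ Xi _] := gr.
have gfE t : g (f t) = 0 by rewrite -[LHS]/(hcomp g f t) gf0.
have [K [i [iinj iex]]] := ker_exists g.
have giE y : g (i y) = 0 by apply/iex; exists y.
have [t|f' fE] := factor_through_inj (f := f) iinj; first by apply/iex/gfE.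
have [[r rf']|[s is1]] := lmas_factor fl fm fE; last first.
  have [[x x0] _] := Xi; have [y gy] := gsurj x.
  move: x0; rewrite -gy -[y]/(hid E y) -is1 /= giE eqxx //.
have rf'E t : r (f' t) = t by rewrite -[RHS]/(hid T t) -rf'.
have [Z [j [jinj jex]]] := ker_exists r.
have [Q [q [qsurj qex]]] := coker_exists (hcomp i j).
have [x /qex[z <-]|g' gE] := factor_through_surj (f := g) qsurj.
  exact: giE.
(* If [s] splits [g'], then [q - s g] lands in the image of [K] in [Q], on which [r] induces a map
   [r']; together they give a retraction of the radical map [f]. *)
have [[s g's]|g'nr] := EM (retraction_mor g').
  have [I [m [c [minj csurj qiE]]]] := image_factor (hcomp q i).
  have qiE' y : q (i y) = m (c y) by rewrite -[LHS]/(hcomp q i y) qiE.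
  have [y cy0|r' rE] := factor_through_surj (f := r) csurj.
    have /qex[z ijz] : q (i y) = 0 by rewrite qiE' cy0 linear0.
    by apply/jex; exists z; apply: iinj.
  have [x|d dE] := factor_through_inj (f := q - hcomp s g) minj.
    have [x' qx'] := qsurj ((q - hcomp s g) x).
    have /iex[y iy] : g x' = 0.
      rewrite gE /= qx' hom_addE linearD /= -[g' (q x)]/(hcomp g' q x) -gE.
      by rewrite linearN -[g' (s _)]/(hcomp g' s (g x)) g's subrr.
    by exists (c y); rewrite -qx' -iy qiE'.
  case/(radmor_section f Ti): frad; exists (hcomp r' d).
  apply: homA_ext => t /=; have -> : d (f t) = c (f' t).
    apply: minj; rewrite -[LHS]/(hcomp m d (f t)) -dE hom_addE hom_oppE /=.
    by rewrite gfE linear0 subr0 fE -qiE'.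
  by rewrite -[LHS]/(hcomp r' c (f' t)) -rE rf'E.
(* Otherwise [g'] factors through [g], and minimality of [g] makes [q] injective, so [Z]
   vanishes. *)
have [u g'u] := ras_nonretraction gr g'nr.
have uq_bij : bijective (hcomp u q) by apply: gm; rewrite hcompA -g'u.
have Z0 z : j z = 0.
  apply: iinj; rewrite linear0; apply: (bij_inj uq_bij); rewrite linear0 /=.
  by have -> : q (i (j z)) = 0 by [apply/qex; exists z]; rewrite linear0.
move=> x; split=> [/iex[y <-]|[t <-]//]; exists (r y); rewrite fE /=; congr (i
  _).
apply/eqP; rewrite -subr_eq0; apply/eqP.
have /jex[z <-] : r (f' (r y) - y) = 0 by rewrite linearB rf'E subrr.
exact: Z0.
Qed.

Lemma mas_almost_split_sequence T E X (f : homA T E) (g : homA E X) :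
  left_almost_split f -> left_minimal f ->
  right_almost_split g -> right_minimal g ->
  ~ injective_module T -> ~ projective_module X -> hcomp g f = 0 ->
  almost_split_sequence f g.
Proof.
move=> fl fm gr gm Tni Xnp gf0.
have finj := las_inj Tni fl; have gsurj := ras_surj Xnp gr.
have [/radicalE frad Ti _] := fl; have [/radicalE grad Xi _] := gr.
have fns := (radmor_section f Ti).1 frad.
have gnr := (radmor_retraction g Xi).1 grad.
split; first by split=> //; apply: mas_exact.
- split=> // [/retraction_surj fsurj|Z a b]; last exact: lmas_factor.
  by have [h [hf _]] := hom_inv (inj_surj_bij finj fsurj); apply: fns; exists h.
- split=> // [/section_inj ginj|Z a b]; last exact: rmas_factor.
  by have [h [_ gh]] := hom_inv (inj_surj_bij ginj gsurj); apply: gnr; exists h.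
Qed.

(** In the pullback of [g] and [v] the map [f] factors as [p f']. If [f'] is a section, the other
    projection [q] splits and [v] lifts. If [p] is a retraction, [g] factors through [v];
    irreducibility of [g] then makes [E] a summand of the indecomposable [V], hence isomorphic to
    it. *)
Lemma ass_lift T E X V (f : homA T E) (g : homA E X) (v : homA V X) :
  almost_split_sequence f g -> indecomposable X -> indecomposable V ->
  ~ retraction_mor v -> exists w, v = hcomp g w.
Proof.
move=> [[finj fgex gsurj] [_ _ firr] [_ _ girr]] [[x0 x0n0] _] Vi vnr.
have [P [p [q [gpvq pqex pq0]]]] := pullback_exists g v.
have gfE t : g (f t) = 0 by apply/fgex; exists t.
have [|f' [/esym pf' qf']] := pullback_univ (a := f) (b := 0) pqex pq0.
  by apply: homA_ext => t /=; rewrite gfE linear0.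
have [[r rf']|[s ps]] := firr _ _ _ pf'.
  have qsurj : hsurjective q.
    move=> y; have [x gx] := gsurj (v y).
    by have [z [_ qz]] := pqex _ _ gx; exists z.
  have [z qz0|c cE] := factor_through_surj (f := hid P - hcomp f' r) qsurj.
    have /fgex[t ft] : g (p z) = 0.
      by rewrite -[LHS]/(hcomp g p z) gpvq /= qz0 linear0.
    have -> : z = f' t.
      apply/eqP; rewrite -subr_eq0; apply/eqP; apply: pq0; rewrite linearB.
        by rewrite -[p (f' t)]/(hcomp p f' t) -pf' ft subrr.
      by rewrite -[q (f' t)]/(hcomp q f' t) qf' qz0 subrr.
    rewrite hom_addE hom_oppE /=.
    by rewrite -[r (f' t)]/(hcomp r f' t) rf' subrr.
  exists (hcomp p c); apply: homA_ext => y; have [z <-] := qsurj y.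
  rewrite -[RHS]/(hcomp g (hcomp p (hcomp c q)) z) -cE hcompDr hcompf1 hcompDr.
  rewrite gpvq hcompNr hcompNr !hcompA gpvq -[hcomp (hcomp v q) f']hcompA qf'.
  by rewrite hcompf0 hcomp0 oppr0 addr0.
have gE : g = hcomp v (hcomp q s) by rewrite hcompA -gpvq -hcompA ps hcompf1.
have [[h hqs]|//] := girr _ _ _ gE.
have [E0|/hom_inv[c [_ qsc]]] := section_indec Vi hqs.
  have [y gy] := gsurj x0; move: x0n0; by rewrite -gy [y]E0 linear0 eqxx.
by exists c; rewrite gE -hcompA qsc hcompf1.
Qed.

(** The dual argument, on the pushout of [f] and [v]. *)
Lemma ass_extend T E X V (f : homA T E) (g : homA E X) (v : homA T V) :
  almost_split_sequence f g -> indecomposable T -> indecomposable V ->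
  ~ section_mor v -> exists w, v = hcomp w f.
Proof.
move=> [[finj fgex gsurj] [_ _ firr] [_ _ girr]] [[t0 t0n0] _] Vi vns.
have [P [p [q [pfqv pqex pqs]]]] := pushout_exists f v.
have gfE t : g (f t) = 0 by apply/fgex; exists t.
have [|g' [/esym g'p g'q]] := pushout_univ (a := g) (b := 0) pqex pqs.
  by apply: homA_ext => t /=; rewrite gfE.
have [[s sp]|[s g's]] := girr _ _ _ g'p; last first.
  have qinj : injective q.
    apply: inj_homP => y qy0; have [|t [/esym ft0 ->]] := pqex 0 y.
      by rewrite linear0.
    by move: ft0; rewrite -(linear0 f) => /finj ->; rewrite linear0.
  have [z|c cE] := factor_through_inj (f := hid P - hcomp s g') qinj.
    have : g' ((hid P - hcomp s g') z) = 0.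
      rewrite hom_addE hom_oppE linearB /=.
      by rewrite -[g' (s _)]/(hcomp g' s (g' z)) g's subrr.
    have [x [y ->]] := pqs ((hid P - hcomp s g') z).
    rewrite linearD -[g' (p x)]/(hcomp g' p x) -g'p -[g' (q y)]/(hcomp g' q y)
      g'q.
    rewrite addr0 => /fgex[t <-]; exists (v t + y).
    by rewrite linearD -[p (f t)]/(hcomp p f t) pfqv.
  exists (hcomp c p); apply: homA_ext => t; apply: qinj.
  rewrite -[RHS]/(hcomp (hcomp q c) (hcomp p f) t) -cE hcompDl hcompNl hcomp1.
  rewrite hcompA -[hcomp (hcomp s g') p]hcompA -g'p hom_addE hom_oppE /=.
  by rewrite gfE linear0 subr0 -[RHS]/(hcomp p f t) pfqv.
have fE : f = hcomp (hcomp s q) v by rewrite -hcompA -pfqv hcompA sp hcomp1.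
have [//|[c sqc]] := firr _ _ _ fE.
have [E0|cbij] := section_indec Vi sqc.
  move: t0n0; have -> : t0 = 0 by apply: finj; rewrite linear0; apply: E0.
  by rewrite eqxx.
have [b [bc cb]] := hom_inv cbij.
have bE : b = hcomp s q by rewrite -[RHS]hcompf1 -cb hcompA sqc hcomp1.
by exists c; rewrite fE hcompA -bE cb hcomp1.
Qed.

Lemma ass_right_almost_split T E X (f : homA T E) (g : homA E X) :
  almost_split_sequence f g -> indecomposable X -> right_almost_split g.
Proof.
move=> fg Xi; have [_ _ [_ gnr _]] := fg.
split=> // [|U u /radicalE ur]; first exact/radicalE/radmor_retraction.
have [I [V [a [b [Vi _ _ ab]]]]] := indec_decomposition U.
have /fin_all_exists[w uaw] i : exists w, hcomp u (a i) = hcomp g w.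
  by apply: (ass_lift fg Xi (Vi i)); apply/radmor_retraction => //; apply:
    radmor_compr.
exists (\sum_i hcomp (w i) (b i)).
rewrite hcomp_sumr -[u]hcompf1 -ab hcomp_sumr; apply: eq_bigr => i _.
by rewrite !hcompA uaw.
Qed.

Lemma ass_left_almost_split T E X (f : homA T E) (g : homA E X) :
  almost_split_sequence f g -> indecomposable T -> left_almost_split f.
Proof.
move=> fg Ti; have [_ [fns _ _] _] := fg.
split=> // [|U u /radicalE ur]; first exact/radicalE/radmor_section.
have [I [V [a [b [Vi _ _ ab]]]]] := indec_decomposition U.
have /fin_all_exists[w uaw] i : exists w, hcomp (b i) u = hcomp w f.
  by apply: (ass_extend fg Ti (Vi i)); apply/radmor_section => //; apply:
    radmor_compl.
exists (\sum_i hcomp (a i) (w i)).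
rewrite hcomp_suml -[u]hcomp1 -ab hcomp_suml; apply: eq_bigr => i _.
by rewrite -!hcompA uaw.
Qed.

End AlmostSplit.


(** * Almost split maps formed by all the arrows at a vertex are minimal *)

(** Passes from families over an enumeration to families over the arrows themselves. The value types
    depend on the arrow, so values are transported along [bK]. *)
Lemma bijective_section (I S : Type) (a : I -> S) (P : S -> Type)
    (r : forall i, P (a i)) :
  bijective a -> exists R : forall s, P s, forall i, R (a i) = r i.
Proof.
case=> b aK bK; exists (fun s => eq_rect (a (b s)) P (r (b s)) s (bK s)) => i.
move: (bK (a i)); rewrite aK => e.
by rewrite (Prop_irrelevance e erefl).
Qed.

(** Separates the arrows whose other end is [y], where isomorphisms can occur, from the remaining
    ones, where every map to or from [y] is radical. *)
Lemma sum_fibre (V : zmodType) (T : Type) (B : T -> finType) (y : T) r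
    (a : 'I_r -> {z & B z}) (F : {z & B z} -> V) : bijective a ->
  \sum_i F (a i) = \sum_(b : B y) F (existT _ y b)
                   + \sum_(i | ~~ `[< tag (a i) = y >]) F (a i).
Proof.
case=> a' aK a'K; rewrite (bigID (fun i => `[< tag (a i) = y >])) /=.
congr (_ + _); pose h b := a' (existT _ y b).
have hinj : injective h.
  move=> b c /(congr1 a); rewrite /h !a'K => bc.
  have tagged_eq (u v : {z & B z}) (e : tag u = tag v) :
      u = v -> eq_rect _ B (tagged u) _ e = tagged v.
    by move=> uv; move: e; rewrite uv => e; rewrite (Prop_irrelevance e erefl).
  exact: (tagged_eq (existT _ y b) (existT _ y c) erefl bc).
transitivity (\sum_(i in h @: [set: B y]) F (a i)); last first.
  rewrite big_imset /=; last by move=> b c _ _; apply: hinj.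
  by apply: eq_big => b; rewrite ?inE // => _; rewrite /h a'K.
apply: eq_bigl => i; apply/idP/imsetP => [/asboolP aiy|[b _ ->]]; last first.
  by apply/asboolP; rewrite /h a'K.
case ai : (a i) aiy => [z b] /= zy; subst z.
by exists b; rewrite ?inE // /h -ai aK.
Qed.

Section Minimality.
Variables (k : closedFieldType) (A : falgType k) (G : ar_component A).

Lemma rep_bij_eq (x y : vert G) (f : homA (rep x) (rep y)) :
  bijective f -> x = y.
Proof. by move=> fbij; apply: rep_skeletal; exists f. Qed.

Lemma radmor_rep (x y : vert G) (f : homA (rep x) (rep y)) :
  x <> y -> radmor f.
Proof.
move=> xy; apply/radmor_indec; [exact: rep_indec|exact: rep_indec|].
by move=> /rep_bij_eq.
Qed.

Section Rows.
Variables (x : vert G) (f : forall s : arr_to x, homA (rep (tag s)) (rep x)).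
Hypothesis frad : forall s, radmor (f s).
Let comb y (c : arr y x -> k) := \sum_b c b *: (f (existT _ y b) : homA (rep y)
  (rep x)).

(** A component of [R] at a vertex other than [y] is radical, and one at [y] is a scalar plus a
    radical map. As the [f s] are radical, only the scalars survive modulo the square of the
    radical. *)
Lemma row_mod_rad2 y r (a : 'I_r -> arr_to x)
    (R : forall s : arr_to x, homA (rep y) (rep (tag s))) : bijective a ->
  exists c : arr y x -> k,
    (forall b, ~ bijective (R (existT _ y b) - c b *: hid (rep y))) /\
    radical2 (\sum_i hcomp (f (a i)) (R (a i)) - comb c).
Proof.
move=> abij.
have [c Rc] := choice (fun b : arr y x =>
  indec_scalar (R (existT _ y b)) (rep_indec y)).
exists c; split=> //; rewrite (sum_fibre y (fun s => hcomp (f s) (R s)) abij).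
rewrite addrAC -sumrB; apply: radical2D.
  apply: radical2_sum => b _ /=.
  rewrite -[f _ in X in radical2 (_ - X)]hcompf1 -hcompZr -hcompNr -hcompDr.
  apply: radical2_comp; first by apply/radmor_indec; [exact: rep_indec|exact:
    rep_indec|exact: Rc].
  exact: (@frad (existT _ y b)).
apply: radical2_sum => i /asboolPn aiy /=.
by apply: radical2_comp; [apply: radmor_rep => /esym|exact: (@frad (a i))].
Qed.

(** The almost split property and [row_mod_rad2] show that the arrows from [y] span; by [arr_dim]
    their number is the dimension. *)
Lemma row_free y r (a : 'I_r -> arr_to x) : bijective a ->
  right_almost_split (hrow (fun i => f (a i))) ->
  forall c : arr y x -> k, radical2 (comb c) -> forall b, c b = 0.
Proof.
move=> abij [_ _ fr].
have spans u : radmor u -> exists c : arr y x -> k, radical2 (u - comb c).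
  move=> /radicalE/fr[w ->].
  have [R aR] := bijective_section (P := fun s => homA (rep y) (rep (tag s)))
    (fun i => hcomp (dproj (fun i => rep (tag (a i))) i) w) abij.
  have [c [_ cr]] := row_mod_rad2 R abij; exists c.
  by rewrite hrow_comp; under eq_bigr do rewrite -aR.
have [e ebij] : exists e : 'I_#|arr y x| -> arr y x, bijective e.
  by exists enum_val; apply: enum_val_bij.
have combE c : comb c = \sum_i c (e i) *: (f (existT _ y (e i)) : homA (rep y)
  (rep x)).
  by rewrite /comb (reindex e) //; apply: onW_bij.
have free := rad_quotient_free (arr_dim y x)
  (f := fun i => f (existT _ y (e i)) : homA (rep y) (rep x)) (fun i => @frad
    (existT _ y (e i))).
move=> c cr b; have [e' eK e'K] := ebij; rewrite -(e'K b).
apply: (free _ (c \o e)) => [u /spans[c' uc']|]; last by rewrite -combE.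
by exists (c' \o e); rewrite -combE.
Qed.

Lemma row_right_minimal r (a : 'I_r -> arr_to x) : bijective a ->
  right_almost_split (hrow (fun i => f (a i))) ->
  right_minimal (hrow (fun i => f (a i))).
Proof.
move=> abij fr h fh; set F := hrow _ in fr fh.
have [g -> Fg0] : exists2 g, h = hid _ + g & hcomp F g = 0.
  exists (h - hid _); first by rewrite addrC subrK.
  by rewrite hcompDr hcompNr fh hcompf1 subrr.
apply: radmor_add_bij; apply: radmor_entries => i j.
set y := tag (a i); set gij := hcomp _ _.
have [R aR] := bijective_section (P := fun s => homA (rep y) (rep (tag s)))
  (fun j => hcomp (dproj _ j) (hcomp g (dinj (fun i => rep (tag (a i))) i)))
    abij.
(* [R] is the column [i] of [g]. Since the row kills [g], the combination of arrows with
   coefficients [c] lies in the square of the radical, so the scalar parts vanish. *)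
have [c [Rc cr]] := row_mod_rad2 R abij.
have c0 : forall b, c b = 0.
  have := row_free abij fr (c := fun b => - c b); move=> H b.
  apply/eqP; rewrite -oppr_eq0; apply/eqP; move: b; apply: H.
  move: cr; under eq_bigr do rewrite aR.
  rewrite -hrow_comp hcompA Fg0 hcomp0 sub0r /comb -sumrN.
  by under eq_bigr do rewrite -scaleNr.
apply/radmor_indec; [exact: rep_indec|exact: rep_indec|].
(* A bijective entry would identify its two vertices; it is then one of the components at [y], which
   [Rc] with scalar zero excludes. *)
rewrite /gij -aR; case: (a j) => z b /= Rbij.
have yz := rep_bij_eq Rbij; move: b Rbij; rewrite -yz => b.
by have := Rc b; rewrite c0 scale0r subr0.
Qed.

End Rows.

Section Columns.
Variables (x : vert G) (f : forall s : arr_from x, homA (rep x) (rep (tag s))).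
Hypothesis frad : forall s, radmor (f s).
Let comb y (c : arr x y -> k) := \sum_b c b *: (f (existT _ y b) : homA (rep x)
  (rep y)).

Lemma col_mod_rad2 y r (a : 'I_r -> arr_from x)
    (R : forall s : arr_from x, homA (rep (tag s)) (rep y)) : bijective a ->
  exists c : arr x y -> k,
    (forall b, ~ bijective (R (existT _ y b) - c b *: hid (rep y))) /\
    radical2 (\sum_i hcomp (R (a i)) (f (a i)) - comb c).
Proof.
move=> abij.
have [c Rc] := choice (fun b : arr x y =>
  indec_scalar (R (existT _ y b)) (rep_indec y)).
exists c; split=> //; rewrite (sum_fibre y (fun s => hcomp (R s) (f s)) abij).
rewrite addrAC -sumrB; apply: radical2D.
  apply: radical2_sum => b _ /=.
  rewrite -[f _ in X in radical2 (_ - X)]hcomp1 -hcompZl -hcompNl -hcompDl.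
  apply: radical2_comp; first exact: (@frad (existT _ y b)).
  by apply/radmor_indec; [exact: rep_indec|exact: rep_indec|exact: Rc].
apply: radical2_sum => i /asboolPn aiy /=.
by apply: radical2_comp; [exact: (@frad (a i))|apply: radmor_rep].
Qed.

Lemma col_free y r (a : 'I_r -> arr_from x) : bijective a ->
  left_almost_split (hcol (fun i => f (a i))) ->
  forall c : arr x y -> k, radical2 (comb c) -> forall b, c b = 0.
Proof.
move=> abij [_ _ fl].
have spans u : radmor u -> exists c : arr x y -> k, radical2 (u - comb c).
  move=> /radicalE/fl[w ->].
  have [R aR] := bijective_section (P := fun s => homA (rep (tag s)) (rep y))
    (fun i => hcomp w (dinj (fun i => rep (tag (a i))) i)) abij.
  have [c [_ cr]] := col_mod_rad2 R abij; exists c.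
  by rewrite hcol_comp; under eq_bigr do rewrite -aR.
have [e ebij] : exists e : 'I_#|arr x y| -> arr x y, bijective e.
  by exists enum_val; apply: enum_val_bij.
have combE c : comb c = \sum_i c (e i) *: (f (existT _ y (e i)) : homA (rep x)
  (rep y)).
  by rewrite /comb (reindex e) //; apply: onW_bij.
have free := rad_quotient_free (arr_dim x y)
  (f := fun i => f (existT _ y (e i)) : homA (rep x) (rep y)) (fun i => @frad
    (existT _ y (e i))).
move=> c cr b; have [e' eK e'K] := ebij; rewrite -(e'K b).
apply: (free _ (c \o e)) => [u /spans[c' uc']|]; last by rewrite -combE.
by exists (c' \o e); rewrite -combE.
Qed.

Lemma col_left_minimal r (a : 'I_r -> arr_from x) : bijective a ->
  left_almost_split (hcol (fun i => f (a i))) ->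
  left_minimal (hcol (fun i => f (a i))).
Proof.
move=> abij fl h hf; set F := hcol _ in fl hf.
have [g -> gF0] : exists2 g, h = hid _ + g & hcomp g F = 0.
  exists (h - hid _); first by rewrite addrC subrK.
  by rewrite hcompDl hcompNl hf hcomp1 subrr.
apply: radmor_add_bij; apply: radmor_entries => i j.
set y := tag (a j); set gij := hcomp _ _.
have [R aR] := bijective_section (P := fun s => homA (rep (tag s)) (rep y))
  (fun i => hcomp (dproj (fun i => rep (tag (a i))) j) (hcomp g (dinj _ i)))
    abij.
have [c [Rc cr]] := col_mod_rad2 R abij.
have c0 : forall b, c b = 0.
  have := col_free abij fl (c := fun b => - c b); move=> H b.
  apply/eqP; rewrite -oppr_eq0; apply/eqP; move: b; apply: H.
  move: cr; under eq_bigr do rewrite aR hcompA.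
  rewrite -hcol_comp -hcompA gF0 hcompf0 sub0r /comb -sumrN.
  by under eq_bigr do rewrite -scaleNr.
apply/radmor_indec; [exact: rep_indec|exact: rep_indec|].
rewrite /gij -aR; case: (a i) => z b /= Rbij.
have zy := rep_bij_eq Rbij; move: b Rbij; rewrite zy => b.
by have := Rc b; rewrite c0 scale0r subr0.
Qed.

End Columns.

End Minimality.


(** * Existence of right almost split maps *)

(* R is the graph of a linear form on a subspace; it is extended to one spanning
   vector after the other. *)
Lemma linear_form_extension (k : fieldType) (H : lmodType k) (I : finType)
    (g : I -> H) (R : H -> k -> Prop) :
  (forall x, exists a : I -> k, x = \sum_i a i *: g i) ->
  R 0 0 -> (forall a x y c d, R x c -> R y d -> R (a *: x + y) (a * c + d)) ->
  (forall c, R 0 c -> c = 0) ->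
  exists psi : H -> k, (forall a x y, psi (a *: x + y) = a * psi x + psi y) /\
    forall x c, R x c -> psi x = c.
Proof.
move=> gspan R0 RP Rfun.
have [R' [RR' R'0 R'P R'fun R'g]] : exists R' : H -> k -> Prop,
    [/\ forall x c, R x c -> R' x c, R' 0 0,
        forall a x y c d, R' x c -> R' y d -> R' (a *: x + y) (a * c + d),
        forall c, R' 0 c -> c = 0 &
        forall i, i \in enum I -> exists c, R' (g i) c].
  elim: (enum I) => [|i s [R' [RR' R'0 R'P R'fun R's]]]; first by exists R.
  have [[c R'c]|nR'] := EM (exists c, R' (g i) c).
    exists R'; split=> // j; rewrite inE => /predU1P[->|/R's//].
    by exists c.
  exists (fun y c => exists t, R' (y - t *: g i) c); split.
  - by move=> x c /RR'; exists 0; rewrite scale0r subr0.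
  - by exists 0; rewrite scale0r subr0.
  - move=> a x y c d [t R't] [t' R't']; exists (a * t + t').
    have -> : a *: x + y - (a * t + t') *: g i =
        a *: (x - t *: g i) + (y - t' *: g i).
      by rewrite scalerBr scalerDl scalerA addrACA opprD.
    exact: R'P.
  - move=> c [t]; rewrite sub0r; have [->|t0] := eqVneq t 0.
      by rewrite scale0r oppr0; apply: R'fun.
    move=> R't; case: nR'; exists (- t^-1 * c + 0).
    have -> : g i = - t^-1 *: (- (t *: g i)) + 0.
      by rewrite addr0 scaleNr scalerN opprK scalerA mulVf // scale1r.
    exact: R'P.
  move=> j; rewrite inE => /predU1P[->|/R's[c R'c]].
    by exists 0, 1; rewrite scale1r subrr.
  by exists c, 0; rewrite scale0r subr0.
have R'tot x : exists c, R' x c.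
  have [a ->] := gspan x; elim/big_ind: _ => [|y z [c R'c] [d R'd]|i _].
  - by exists 0.
  - by exists (1 * c + d); rewrite -[y]scale1r; apply: R'P.
  - have [c R'c] := R'g i (mem_enum _ _).
    by exists (a i * c + 0); rewrite -[_ *: _]addr0; apply: R'P.
have R'uniq x c d : R' x c -> R' x d -> c = d.
  move=> R'c R'd; apply/eqP; rewrite -subr_eq0; apply/eqP/R'fun.
  have -> : c - d = -1 * d + c by rewrite mulN1r addrC.
  have -> : 0 = -1 *: x + x by rewrite scaleN1r addNr.
  exact: R'P.
have [psi R'psi] := choice R'tot; exists psi; split=> [a x y|x c /RR'].
  by apply: (R'uniq (a *: x + y)); [|apply: R'P].
exact: R'uniq.
Qed.

(** A right inverse of [p] identifies [S] with a subset of [F], which is enumerated. *)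
Lemma surj_enum (F : finType) (S : Type) (p : F -> S) :
  (forall s, exists f, p f = s) -> exists r (a : 'I_r -> S), bijective a.
Proof.
move=> /choice[j pj].
pose Q := [pred f | `[< exists s, j s = f >]].
have jQ s : j s \in Q by rewrite inE; apply/asboolP; exists s.
exists #|Q|, (fun i => p (enum_val i)), (fun s => enum_rank_in (jQ s) (j s)).
  move=> i; apply: enum_val_inj; rewrite enum_rankK_in //.
  have : enum_val i \in Q by apply: enum_valP.
  by rewrite inE => /asboolP[s <-]; rewrite pj.
by move=> s; rewrite enum_rankK_in.
Qed.

Section AuslanderReiten.
Variables (k : fieldType) (A : falgType k).
Implicit Types M N P U V W X Y Z E T Q : fgmod A.

Lemma surj_cancel X Y Z (p : homA X Y) (f g : homA Y Z) :
  hsurjective p -> hcomp f p = hcomp g p -> f = g.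
Proof.
move=> ps fpgp; apply: homA_ext => y; have [x <-] := ps y.
by rewrite -[LHS]/(hcomp f p x) fpgp.
Qed.

Lemma hom_expand P M n (e : 'I_n -> P) (h : 'I_n -> homA P (regA A)) :
  (forall x, x = \sum_i (h i x : A^c) *: e i) ->
  forall b : homA P M, b = \sum_i hcomp (scalar_hom (b (e i))) (h i).
Proof.
move=> eh b; apply: homA_ext => x; rewrite hom_sumE [in LHS](eh x) linear_sum.
by apply: eq_bigr => i _; rewrite linearZ.
Qed.

Fact scalar_homP M (c : k) (m m' : kmod M) :
  scalar_hom (c *: m + m') = c *: scalar_hom m + scalar_hom m'.
Proof.
apply: homA_ext => a; rewrite hom_addE hom_scaleE /= kmodZ scalerDr !scalerA.
congr (_ + _).
have -> // : (a : A^c) * (c%:A : A^c) = (c%:A : A^c) * (a : A^c).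
have /= : @GRing.mul A c%:A a = @GRing.mul A a c%:A by rewrite mulr_algr
  mulr_algl.
exact.
Qed.

(** Supplies the finite spanning family over [k] that [linear_form_extension] requires. *)
Lemma hom_span P M : has_dual_basis P ->
  exists (I : finType) (g : I -> homA P M),
    forall x, exists a : I -> k, x = \sum_i a i *: g i.
Proof.
move=> [n [e [h eh]]]; have [J [m mspan]] := kmod_span M.
exists ('I_n * J)%type, (fun ij => hcomp (scalar_hom (m ij.2 : M)) (h ij.1)) =>
  b.
have [a ba] := choice (fun i => mspan (b (e i))).
exists (fun ij => a ij.1 ij.2).
rewrite -(pair_bigA _ (fun i j => a i j *: hcomp (scalar_hom (m j : M)) (h i)))
  /=.
rewrite [LHS](hom_expand eh); apply: eq_bigr => i _; rewrite ba.
have sh0 : scalar_hom (0 : M) = 0.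
  by apply: homA_ext => x /=; rewrite scaler0.
rewrite (big_morph (fun u : kmod M => scalar_hom (u : M)) (id1 := 0) (op1 :=
  +%R)) //.
  rewrite hcomp_suml; apply: eq_bigr => j _.
  by rewrite -[X in scalar_hom X]addr0 scalar_homP sh0 addr0 hcompZl.
by move=> u v; rewrite -[u]scale1r scalar_homP !scale1r.
Qed.

Section TransposeDual.
Variables (X T P1 P0 : fgmod A) (p1 : homA P1 P0).
Variable t : T -> {scalar homA P1 (regA A)}.
Hypothesis tD : forall x y g, t (x + y) g = t x g + t y g.
Hypothesis tZ : forall (a : A) x g, t ((a : A^c) *: x) g = t x (lmul a g).
Hypothesis t_inj : forall x, (forall g, t x g = 0) -> x = 0.
Hypothesis t_im : forall phi : {scalar homA P1 (regA A)},
  (forall h : homA P0 (regA A), phi (hcomp h p1) = 0) <->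
  (exists x, forall g, phi g = t x g).

Lemma DTr_eq x y : (forall g, t x g = t y g) -> x = y.
Proof.
move=> txy; apply/eqP; rewrite -subr_eq0; apply/eqP/t_inj => g.
by apply: (addIr (t y g)); rewrite -tD subrK add0r.
Qed.

(** This is the passage from D Hom(P1, M) to Hom(M, D Hom(P1, A)); forms that vanish on the maps
    factoring through [p1] land in the submodule D Tr X. *)
Lemma DTr_hom M (psi : homA P1 M -> k) :
  (forall a f g, psi (a *: f + g) = a * psi f + psi g) ->
  (forall c : homA P0 M, psi (hcomp c p1) = 0) ->
  exists eta : homA M T,
    forall m g, t (eta m) g = psi (hcomp (scalar_hom m) g).
Proof.
move=> psiP psi0.
have ex m : exists x, forall g, t x g = psi (hcomp (scalar_hom m) g).
  pose f g := psi (hcomp (scalar_hom m) g).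
  have flin : linear_for *%R f.
    by move=> a g g'; rewrite /f hcompDr hcompZr psiP.
  pose phi : {scalar homA P1 (regA A)} :=
    HB.pack f (GRing.isLinear.Build k (homA P1 (regA A)) k *%R f flin).
  have /t_im[x xE] : forall h : homA P0 (regA A), phi (hcomp h p1) = 0.
    by move=> h; rewrite -[LHS]/(psi _) hcompA psi0.
  by exists x => g; rewrite -xE.
have [eta etaE] := choice ex.
have eta_lin : linear eta.
  move=> a x y; apply: DTr_eq => g; rewrite tD tZ !etaE.
  rewrite -[X in _ = X + _]mul1r -psiP scale1r; congr (psi _).
  by apply: homA_ext => z; rewrite hom_addE /= scalerDr scalerA.
by exists (mkhom eta_lin).
Qed.

(** Conversely, [zeta] defines a linear form on Hom(P1, P0) that vanishes on maps factoring through
    [p1], and the sum is its value at [p1] itself. The dual basis of [P0] moves [p1] into the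
    argument of [t]. *)
Lemma DTr_vanish (zeta : homA P0 T) n (e : 'I_n -> P1)
    (h : 'I_n -> homA P1 (regA A)) :
  has_dual_basis P0 -> (forall x, x = \sum_i (h i x : A^c) *: e i) ->
  \sum_i t (zeta (p1 (e i))) (h i) = 0.
Proof.
move=> [m [e' [h' eh']]] eh.
have t0 g : t 0 g = 0 by apply: (addIr (t 0 g)); rewrite -tD !add0r.
pose F i j : k := t (zeta (e' j)) (lmul (h' j (p1 (e i))) (h i)).
transitivity (\sum_i \sum_j F i j).
  apply: eq_bigr => i _; rewrite [in LHS](eh' (p1 (e i))) linear_sum.
  rewrite (big_morph (fun x => t x (h i)) (fun x y => tD x y (h i)) (t0 (h i))).
  by apply: eq_bigr => j _; rewrite linearZ; apply: tZ.
rewrite exchange_big big1 // => j _; rewrite /F -linear_sum.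
have -> : \sum_i lmul (h' j (p1 (e i))) (h i) = hcomp (h' j) p1.
  apply: homA_ext => x; rewrite hom_sumE /= [in RHS](eh x) !linear_sum.
  by apply: eq_bigr => i _; rewrite !linearZ.
pose phi := t (zeta (e' j)); have /t_im : exists x, forall g, phi g = t x g.
  by exists (zeta (e' j)).
exact.
Qed.

End TransposeDual.

(* E is the pushout of p1 : P1 -> P0 along the map xi : P1 -> DTr X given by a
   linear form phi on Hom(P1, P0) that is 1 on p1 and vanishes on c p1 whenever
   c induces a radical endomorphism of X. The former makes E -> X nonsplit. A
   non-retraction v : V -> X, with a free cover q : Q -> V lifted to
   v' : Q -> P0, factors through E once xi extends along v' from the kernel of q
   to Q, and by the latter the corresponding linear form on maps P1 -> ker q
   extends to Hom(P1, Q). *)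
Lemma nonprojective_ras X T : indecomposable X -> ~ projective_module X ->
  is_DTr X T -> exists E (g : homA E X), ~ retraction_mor g /\
    forall V (v : homA V X), ~ retraction_mor v -> exists w, v = hcomp g w.
Proof.
move=> Xi Xnp [P1 [P0 [p1 [p0 [t [[[/projectiveE P1d /projectiveE P0d] ex01 p0s
  _ _]]]]]]].
move=> [tD tZ t_inj t_im].
have p0p1 z : p0 (p1 z) = 0 by apply/ex01; exists z.
have p0p1_0 : hcomp p0 p1 = 0 by apply: homA_ext.
have through_p0 Y (f : homA P0 Y) : hcomp f p1 = 0 -> exists h, f = hcomp h p0.
  move=> fp1; apply: (factor_through_surj p0s) => x /ex01[z <-].
  by rewrite -[LHS]/(hcomp f p1 z) fp1.
have [phi [phiP [phi1 phi0]]] : exists phi : homA P1 P0 -> k,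
    (forall a f g, phi (a *: f + g) = a * phi f + phi g) /\ phi p1 = 1 /\
    forall (c : homA P0 P0) (s : homA X X), radmor s ->
      hcomp p0 c = hcomp s p0 -> phi (hcomp c p1) = 0.
  pose R (h : homA P1 P0) (a : k) := exists (c : homA P0 P0) (s : homA X X),
    [/\ radmor s, hcomp p0 c = hcomp s p0 & h = hcomp c p1 + a *: p1].
  have [I [g gspan]] := hom_span P0 P1d.
  have [| |a Ra|phi [phiP phiR]] := linear_form_extension (R := R) gspan.
  - exists 0, 0; split; first exact: radmor0.
      by rewrite hcompf0 hcomp0.
    by rewrite hcomp0 scale0r addr0.
  - move=> a h h' b b' [c [s [sr cs ->]]] [c' [s' [s'r cs' ->]]].
    exists (a *: c + c'), (a *: s + s'); split.
    + by apply: radmorD => //; apply: radmorZ.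
    + by rewrite hcompDr hcompDl hcompZr hcompZl cs cs'.
    + by rewrite hcompDl hcompZl scalerDr scalerDl scalerA addrACA.
  (* The values prescribed by [R] are consistent: for [a] nonzero, [1 + a^-1 c] would kill [p1] and
     so equal [w p0]. Then [p0 w = 1 + a^-1 s] is invertible, [p0] splits and [X] is projective. *)
  - have [->//|a0] := eqVneq a 0; exfalso.
    have [c [s [sr cs /esym/eqP]]] := Ra; rewrite addr_eq0 => /eqP cp1.
    have [|w wE] := through_p0 _ (hid P0 + a^-1 *: c).
      by rewrite hcompDl hcomp1 hcompZl cp1 scalerN scalerA mulVf // scale1r
        subrr.
    have pw : hid X + a^-1 *: s = hcomp p0 w.
      apply: (surj_cancel p0s); rewrite -hcompA -wE hcompDl hcompDr.
      by rewrite hcomp1 hcompf1 hcompZl hcompZr cs.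
    have /hom_inv[b [_ pwb]] : bijective (hcomp p0 w).
      by rewrite -pw; apply/radmor_add_bij/radmorZ.
    apply/Xnp/projectiveE/(dual_basis_retract (p := p0) P0d).
    by exists (hcomp w b); rewrite hcompA.
  exists phi; split=> //; split.
    apply: phiR; exists 0, 0; split; first exact: radmor0.
      by rewrite hcompf0 hcomp0.
    by rewrite hcomp0 scale1r add0r.
  by move=> c s sr cs; apply: phiR; exists c, s; rewrite scale0r addr0.
have phi00 : phi 0 = 0.
  by rewrite -(hcomp0 P0 p1); apply: (phi0 _ 0); [apply: radmor0|rewrite
    hcompf0 hcomp0].
have phiN f : phi (- f) = - phi f.
  by rewrite -scaleN1r -[_ *: f]addr0 phiP phi00 mulN1r addr0.
have phi_sum n (f : 'I_n -> homA P1 P0) : phi (\sum_i f i) = \sum_i phi (f i).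
  apply: (big_morph phi) => // f1 f2.
  by rewrite -[f1]scale1r phiP mul1r scale1r.
have [||xi xiE] := DTr_hom tD tZ t_inj t_im (psi := fun b : homA P1 P1 => phi
  (hcomp p1 b)).
- by move=> a f g; rewrite hcompDr hcompZr phiP.
(* The map [p1 c] induces the zero endomorphism of [X], which is radical. *)
- move=> c; rewrite hcompA; apply: (phi0 _ 0); first exact: radmor0.
  by rewrite hcompA p0p1_0 !hcomp0.
have {}xiE z g : t (xi z) g = phi (hcomp (scalar_hom (p1 z)) g).
  by rewrite xiE; congr (phi _); apply: homA_ext => x; rewrite /= linearZ.
have xi_eq z z' : p1 z = p1 z' -> xi z = xi z'.
  by move=> zz'; apply: (DTr_eq tD t_inj) => g; rewrite !xiE zz'.
have [E [pi [pis piex]]] := coker_exists (hpair (- xi) p1).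
have [u /piex[z <-]|g gE] := factor_through_surj (f := hcopair (0 : homA T X)
  p0) pis.
  by rewrite /= p0p1 addr0.
have gpi u : g (pi u) = p0 u.2.
  by rewrite -[LHS]/(hcomp g pi u) -gE /= add0r.
exists E, g; split=> [[s gs]|V v vnr].
  (* A splitting [s] would extend [xi] along [p1]: lifting [s p0] to the pair [alpha], [beta] and
     writing [1 - beta = p1 gamma], the extension is [xi gamma - alpha]. By [DTr_vanish] this would
     give [phi p1 = 0]. *)
  have [x|l lE] := dual_basis_lift (g := pi) (f := hcomp s p0) P0d.
    by have [u pu] := pis (hcomp s p0 x); exists u.
  have lE' x : pi (l x) = s (p0 x) by rewrite -[LHS]/(hcomp pi l x) -lE.
  have fst_lin : linear (fun x => (l x).1) by move=> a x y; rewrite linearP.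
  have snd_lin : linear (fun x => (l x).2) by move=> a x y; rewrite linearP.
  pose alpha := mkhom fst_lin; pose beta := mkhom snd_lin.
  have [x|gamma gammaE] := dual_basis_lift (g := p1) (f := hid P0 - beta) P0d.
    apply/ex01; rewrite linearB /= -gpi lE' -[g _]/(hcomp g s (p0 x)) gs.
    by rewrite subrr.
  have gamE x : p1 (gamma x) = x - beta x.
    by rewrite -[LHS]/(hcomp p1 gamma x) -gammaE.
  have [n [e [h eh]]] := P1d.
  have := DTr_vanish tD tZ t_im (hcomp xi gamma - alpha) P0d eh.
  rewrite (eq_bigr (fun i => phi (hcomp (scalar_hom (p1 (e i))) (h i)))).
    by rewrite -phi_sum -(hom_expand eh) phi1 => /eqP; rewrite oner_eq0.
  move=> i _; rewrite -xiE; congr (t _ _); set z := e i.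
  have /piex[z' z'E] : pi (l (p1 z)) = 0 by rewrite lE' p0p1 linear0.
  have -> : (hcomp xi gamma - alpha) (p1 z) = xi (gamma (p1 z)) + xi z'.
    rewrite hom_addE hom_oppE /= -z'E /= opprK //.
  rewrite -linearD; apply: xi_eq; rewrite linearD gamE /= -z'E /=.
  by rewrite subrK.
have vr : radmor v by apply/radmor_retraction.
have [n [q qs]] := free_cover V; have Qd := free_dual_basis A n.
have [x|v' v'E] := dual_basis_lift (g := p0) (f := hcomp v q) Qd; first exact:
  p0s.
have v'E' y : p0 (v' y) = v (q y) by rewrite -[LHS]/(hcomp p0 v' y) -v'E.
have [psi [psiP psiR]] : exists psi : homA P1 (freem A n) -> k,
    (forall a f g, psi (a *: f + g) = a * psi f + psi g) /\
    forall (b : homA P1 (freem A n)) c, hcomp q b = 0 ->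
      psi (b + hcomp c p1) = phi (hcomp v' b).
  pose R (h : homA P1 (freem A n)) (a : k) := exists b c,
    [/\ hcomp q b = 0, h = b + hcomp c p1 & a = phi (hcomp v' b)].
  have [I [g' gspan]] := hom_span (freem A n) P1d.
  have [| |a|psi [psiP psiR]] := linear_form_extension (R := R) gspan.
  - by exists 0, 0; rewrite !hcompf0 hcomp0 addr0 phi00.
  - move=> a x y d d' [b [c [qb -> ->]]] [b' [c' [qb' -> ->]]].
    exists (a *: b + b'), (a *: c + c'); split.
    + by rewrite hcompDr hcompZr qb qb' scaler0 addr0.
    + by rewrite hcompDl hcompZl scalerDr addrACA.
    + by rewrite hcompDr hcompZr phiP.
  (* Consistency again: if [b = - c p1] and [q b = 0], then [q c = s p0] for some [s]. So [v' c]
     induces the radical endomorphism [v s] of [X], and [phi] vanishes on [v' c p1]. *)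
  - move=> [b [c [qb /esym/eqP]]]; rewrite addr_eq0 => /eqP bc ->.
    have [|s sE] := through_p0 _ (hcomp q c).
      by rewrite -hcompA -[hcomp c p1]opprK -bc hcompNr qb oppr0.
    rewrite bc hcompNr phiN hcompA (phi0 _ (hcomp v s)) ?oppr0 //.
      exact: radmor_compr.
    by rewrite hcompA -v'E -!hcompA sE.
  by exists psi; split=> // b c qb; apply: psiR; exists b, c.
have [c|eta etaE] := DTr_hom tD tZ t_inj t_im psiP.
  by rewrite -[hcomp c p1]add0r psiR hcompf0.
(* On the kernel of [q], [v'] takes values in the image of [p1] and [eta] agrees with [xi] there, so
   the pair dies in [E] and descends to [V]. *)
have [y qy0|w wE] := factor_through_surj (f := hcomp pi (hpair (- eta) v')) qs.
  have /ex01[z zE] : p0 (v' y) = 0 by rewrite v'E' qy0 linear0.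
  have etay : eta y = xi z.
    apply: (DTr_eq tD t_inj) => f; rewrite etaE xiE zE.
    rewrite -[X in psi X]addr0 -(hcomp0 _ p1) psiR.
      by congr (phi _); apply: homA_ext => x; rewrite /= linearZ.
    by apply: homA_ext => x; rewrite /= linearZ /= qy0 scaler0.
  by apply/piex; exists z; rewrite /= etay zE.
exists w; apply: (surj_cancel qs); rewrite -hcompA -wE; apply: homA_ext => y.
by rewrite /= gpi /= v'E'.
Qed.

(** [E] is the radical of [P], described as the set of [x] for which [scalar_hom x], the map from
    the regular module sending 1 to [x], is radical. *)
Lemma projective_ras P : indecomposable P -> projective_module P ->
  exists E (g : homA E P), ~ retraction_mor g /\
    forall V (v : homA V P), ~ retraction_mor v -> exists w, v = hcomp g w.
Proof.
move=> Pi /projectiveE[n [e [h eh]]].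
have S0 : radmor (scalar_hom (0 : P)).
  by have -> : scalar_hom (0 : P) = 0;
    [apply: homA_ext => x /=; rewrite scaler0|apply: radmor0].
have SP a (x y : P) : radmor (scalar_hom x) -> radmor (scalar_hom y) ->
    radmor (scalar_hom (a *: x + y)).
  move=> xr yr; have -> : scalar_hom (a *: x + y) =
      hcomp (scalar_hom x) (scalar_hom (a : regm A)) + scalar_hom y.
    by apply: homA_ext => z; rewrite hom_addE /= scalerDr scalerA.
  by apply: radmorD => //; apply: radmor_compr.
have [E [g [ginj gim]]] := submodule_exists (Submodule S0 SP).
exists E, g; split=> [/retraction_surj gs|V v /radmor_retraction vr].
  apply: (indec_id_nonrad Pi); rewrite (hom_expand eh (hid P)).
  apply: radmor_sum => i _; apply: radmor_compr; apply/gim.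
  exact: gs.
apply: factor_through_inj => // y; apply/gim; rewrite /=.
have -> : scalar_hom (v y) = hcomp v (scalar_hom y).
  by apply: homA_ext => a; rewrite /= linearZ.
exact/radmor_compr/vr.
Qed.

Variable G : ar_component A.

Lemma ras_exists (x : vert G) : exists E (g : homA E (rep x)), radmor g /\
  forall V (v : homA V (rep x)), radmor v -> exists w, v = hcomp g w.
Proof.
have xi := rep_indec x.
have [E [g [gnr gl]]] : exists E (g : homA E (rep x)), ~ retraction_mor g /\
    forall V (v : homA V (rep x)), ~ retraction_mor v -> exists w, v = hcomp g
      w.
  have [xp|xnp] := EM (projective_module (rep x)); first exact: projective_ras.
  exact: (nonprojective_ras xi xnp (tau_DTr (exist _ x xnp))).
exists E, g; split; first exact/radmor_retraction.
by move=> V v /radmor_retraction vr; apply/gl/vr.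
Qed.

(** An arrow from [y] gives a radical map outside the square of the radical. It factors through [E],
    so [rep y] must be isomorphic to one of the finitely many indecomposable summands of [E];
    between two given vertices there are finitely many arrows. *)
Lemma arr_to_finite (x : vert G) : exists r (a : 'I_r -> arr_to x), bijective a.
Proof.
have [E [g [gr gl]]] := ras_exists x.
have [I [U [a [b [Ui _ _ ab]]]]] := indec_decomposition E.
have arr_iso y : arr y x -> exists i, isomorphic (rep y) (U i).
  move=> al; have [n0 [br bspan bfree]] := arr_dim y x.
  pose i0 : 'I_#|arr y x| := enum_rank al.
  (* Indicator coefficients turn independence into the statement about a single basis element. *)
  have ni0 : ~ radical2 (n0 i0).
    move=> r0; have := bfree (fun i => (i == i0)%:R) _ i0; rewrite eqxx => H.
    suff /H/eqP : radical2 (\sum_i (i == i0)%:R *: n0 i) by rewrite oner_eq0.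
    rewrite (bigD1 i0) //= eqxx scale1r big1 ?addr0 // => i /negPf->.
    by rewrite scale0r.
  have [w wE] := gl _ _ ((radicalE _).1 (br i0)).
  apply: contrapT => niso; apply: ni0.
  rewrite wE -[w]hcomp1 -ab hcomp_suml hcomp_sumr; apply: radical2_sum => i _.
  rewrite -hcompA hcompA; apply: radical2_comp; last exact: radmor_compr.
  apply/radmor_indec; [exact: rep_indec|exact: Ui|].
  by move=> bw; apply: niso; exists i, (hcomp (b i) w).
(* Summands isomorphic to no vertex of the component receive the dummy vertex [x]. *)
have /choice[yy yyP] : forall i, exists y : vert G,
    (exists z : vert G, isomorphic (rep z) (U i)) -> isomorphic (rep y) (U i).
  move=> i; have [[y yi]|n] := EM (exists z : vert G, isomorphic (rep z) (U i)).
    by exists y.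
  by exists x => /n.
apply: (@surj_enum {i : I & arr (yy i) x} _ (fun s => existT _ (yy (tag s))
  (tagged s))).
move=> [y al]; have [i iso] := arr_iso y al.
have [f fbij] := iso; have [|f' f'bij] := yyP i; first by exists y.
have yE : y = yy i.
  apply: rep_skeletal; have [h [hf' f'h]] := hom_inv f'bij.
  exists (hcomp h f); apply: hcomp_bij => //; exact: (hinv_bij f'h hf').
by move: al; rewrite yE => al; exists (existT _ i al).
Qed.

End AuslanderReiten.


(** * Functors on the mesh category *)

Lemma kclass0 (k : fieldType) (V : Type) (C : kcategory k V) (I : kideal C)
    (x y : V) : kclass I (0 : khom C x y) = 0.
Proof. exact: (raddf0 (\pi_({ideal_quot (@kideal_pred _ _ _ I x y)}))). Qed.

Section MeshFunctor.
Variables (k : fieldType) (A : falgType k) (G : ar_component A).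
Variable f : forall x y : vert G, arr x y -> homA (rep x) (rep y).

Fixpoint path_eval (x y : vert G) (p : qpath (fun x y : vert G => arr x y) x y)
  :
    homA (rep x) (rep y) :=
  match p with
  | qnil x => hid (rep x)
  | qcons _ _ _ a q => hcomp (path_eval q) (f a)
  end.

Lemma path_eval_cat x y z (p : qpath (fun x y : vert G => arr x y) x y)
    (q : qpath (fun x y : vert G => arr x y) y z) :
  path_eval (qcat p q) = hcomp (path_eval q) (path_eval p).
Proof.
elim: p q => [u q|u v w a p IHp q] /=; first by rewrite hcompf1.
by rewrite IHp hcompA.
Qed.

Definition kpath_eval (x y : vert G) (u : khom (kpath G) x y) :
    homA (rep x) (rep y) :=
  lin_ext (@path_eval x y) u.

Fact kpath_eval_linear x y : linear (@kpath_eval x y).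
Proof. exact: lin_extP. Qed.

Lemma kpath_eval_class x y (p : qpath (fun x y : vert G => arr x y) x y) :
  kpath_eval (path_class k p) = path_eval p.
Proof. exact: lin_extU. Qed.

Lemma kpath_eval_comp x y z (u : khom (kpath G) x y) (v : khom (kpath G) y z) :
  kpath_eval (kcomp u v) = hcomp (kpath_eval v) (kpath_eval u).
Proof.
move: u; apply: lin_ext_uniq => [c u u'|c u u'|p].
- by rewrite kcompPl kpath_eval_linear.
- by rewrite kpath_eval_linear hcompDr hcompZr.
move: v; apply: lin_ext_uniq => [c v v'|c v v'|q].
- by rewrite kcompPr kpath_eval_linear.
- by rewrite kpath_eval_linear hcompDl hcompZl.
rewrite -!/(path_class _ _) -[kcomp _ _]/(path_comp _ _) path_comp_class.
by rewrite !kpath_eval_class path_eval_cat.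
Qed.

Lemma kpath_eval0 x y : kpath_eval (0 : khom (kpath G) x y) = 0.
Proof. by have := kpath_eval_linear (-1) (0 : khom (kpath G) x y) 0;
  rewrite scaler0 addr0 scaleN1r addNr. Qed.

Lemma kpath_eval_sum x y I (s : seq I) (u : I -> khom (kpath G) x y) :
  kpath_eval (\sum_(i <- s) u i) = \sum_(i <- s) kpath_eval (u i).
Proof.
apply: (big_morph (@kpath_eval x y)) => [v w|]; last exact: kpath_eval0.
by have := kpath_eval_linear 1 v w; rewrite !scale1r.
Qed.

(** Membership in [mesh_ideal] means membership in every ideal containing the mesh relations; it is
    applied to this ideal in [mesh_functor_exists]. *)
Definition kpath_eval_ker : kideal (kpath G).
Proof.
apply: (@KIdeal _ _ _ (fun x y u => kpath_eval u = 0)).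
- exact: kpath_eval0.
- by move=> x y c u v u0 v0; rewrite kpath_eval_linear u0 v0 scaler0 addr0.
- by move=> x y z u v v0; rewrite kpath_eval_comp v0 hcomp0.
- by move=> x y z u v u0; rewrite kpath_eval_comp u0 hcompf0.
Defined.

Lemma mesh_functor_exists :
  (forall (x : nonprojective G) (r : nat) (a : 'I_r -> arr_to (sval x)),
    bijective a -> \sum_i hcomp (f (tagged (a i))) (f (sigma (tagged (a i)))) =
      0) ->
  exists F : kfunctor (mesh_category G) (ind_category G),
    forall (x y : vert G) (a : arr x y), F x y (arrow_class a) = f a.
Proof.
move=> fmesh.
have mesh0 x y (u : khom (kpath G) x y) : mesh_ideal G x y u -> kpath_eval u =
  0.
  move=> Iu; apply: (Iu kpath_eval_ker) => {u Iu x y} _ _ _ [x r a abij] /=.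
  rewrite kpath_eval_sum -[RHS](fmesh x r a abij); apply: eq_bigr => i _.
  by rewrite kpath_eval_class /= hcomp1.
(* The evaluation uses a chosen representative; [mesh0] makes the result independent of it, as
   recorded in [evE]. *)
pose ev x y (u : khom (mesh_category G) x y) := kpath_eval (krepr u).
have evE x y (u : khom (kpath G) x y) : ev x y (kclass (mesh_ideal G) u) =
  kpath_eval u.
  apply/eqP; rewrite -subr_eq0 -scaleN1r addrC -kpath_eval_linear;
    apply/eqP/mesh0.
  by rewrite scaleN1r addrC; apply: kreprP.
have ev_lin x y : linear (ev x y).
  move=> c u v; rewrite -[u]kreprK -[v]kreprK -[c *: _ + _]kclassP !evE.
  exact: kpath_eval_linear.
have ev_id x : ev x x (kid (mesh_category G) x) = kid (ind_category G) x.
  by rewrite evE; apply: kpath_eval_class.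
have ev_comp x y z (u : khom (mesh_category G) x y) (v : khom (mesh_category G)
  y z) :
    ev x z (kcomp u v) = @kcomp _ _ (ind_category G) x y z (ev x y u) (ev y z
      v).
  rewrite -[u]kreprK -[v]kreprK -[kcomp _ _]/(kquot_comp _ _) kclass_comp !evE.
  exact: kpath_eval_comp.
pose ev' x y : khom (mesh_category G) x y -> khom (ind_category G) x y := ev x
  y.
have ev'_lin x y : linear (ev' x y) := ev_lin x y.
exists (KFunctor ev'_lin ev_id ev_comp) => x y a.
by rewrite -[LHS]/(ev _ _ _) evE kpath_eval_class /= hcomp1.
Qed.

End MeshFunctor.

(** * Meshes under a functor, and the equivalence *)

Section MeshComparable.
Variables (k : closedFieldType) (A : falgType k) (G : ar_component A).

(** By functoriality the product is the image under [F] of the class of a mesh relation. *)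
Lemma mesh_row_col (F : kfunctor (mesh_category G) (ind_category G))
    (x : nonprojective G) r (a : 'I_r -> arr_to (sval x)) : bijective a ->
  hcomp (hrow (fun i => F _ _ (arrow_class (tagged (a i)))))
        (hcol (fun i => F _ _ (arrow_class (sigma (tagged (a i)))))) = 0.
Proof.
move=> abij; rewrite hrow_hcol.
have FD u v (g h : khom (mesh_category G) u v) : F _ _ (g + h) = F _ _ g + F _
  _ h.
  by have := kfunP F 1 g h; rewrite !scale1r.
have F0 u v : F _ _ (0 : khom (mesh_category G) u v) = 0.
  by have := kfunP F (-1) (0 : khom (mesh_category G) u v) 0;
    rewrite scaler0 addr0 scaleN1r addNr.
pose m i : khom (mesh_category G) (tau x) (sval x) :=
  kcomp (arrow_class (sigma (tagged (a i)))) (arrow_class (tagged (a i))).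
transitivity (F _ _ (\sum_i m i)).
  rewrite (big_morph (F (tau x) (sval x)) (@FD _ _) (F0 _ _)).
  by apply: eq_bigr => i _; rewrite kfun_comp.
rewrite -[RHS](F0 (tau x) (sval x)); congr (F _ _ _).
pose p i : khom (kpath G) (tau x) (sval x) := path_class k
  (qcons (sigma (tagged (a i))) (qcons (tagged (a i)) (qnil (sval x)))).
transitivity (kclass (mesh_ideal G) (\sum_i p i)); last first.
  rewrite -(kclass0 (mesh_ideal G) (tau x) (sval x)).
  have meshI (J : kideal (kpath G)) : (forall u v (g : khom (kpath G) u v),
      mesh_relation g -> J u v g) -> J _ _ (\sum_i p i).
    by apply; apply: MeshRelation.
  by apply/kclass_eqP; rewrite subr0; apply: meshI.
rewrite (big_morph (@kclass _ _ _ (mesh_ideal G) (tau x) (sval x))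
  (id1 := 0) (op1 := +%R)).
- apply: eq_bigr => i _.
  rewrite /m -[kcomp _ _]/(kquot_comp _ _) kclass_comp; congr (kclass _ _).
  by rewrite -[kcomp _ _]/(path_comp _ _) path_comp_class.
- by move=> u v; apply: kclassD.
- exact: kclass0.
Qed.

Definition sigma_from (x : nonprojective G) (s : arr_to (sval x)) :
    arr_from (tau x) :=
  existT _ (tag s) (sigma (tagged s)).

(** It turns enumerations of the arrows ending at [x] into enumerations of the arrows starting at
    [tau x], and back, so that row and column conditions meet in one mesh. *)
Lemma sigma_from_bij (x : nonprojective G) : bijective (@sigma_from x).
Proof.
have ex y : exists t, cancel (@sigma _ _ _ x y) t /\ cancel t (@sigma _ _ _ x
  y).
  by case: (sigma_bij x y) => t sK tK; exists t.
pose t y := projT1 (cid (ex y)).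
have sK y : cancel (@sigma _ _ _ x y) (t y) by rewrite /t; case: cid => ? [].
have tK y : cancel (t y) (@sigma _ _ _ x y) by rewrite /t; case: cid => ? [].
exists (fun s => existT _ (tag s) (t _ (tagged s))) => -[y b].
  by rewrite /sigma_from /= sK.
by rewrite /sigma_from /= tK.
Qed.

End MeshComparable.

Theorem proposition2p4 (k : closedFieldType) (A : falgType k)
    (G : ar_component A) :
  mesh_comparable G <->
  exists f : forall x y : vert G, arr x y -> homA (rep x) (rep y),
    (forall (x y : vert G) (a : arr x y), irreducible_ind (f x y a)) /\
    (forall x : vert G, projective_module (rep x) ->
       forall (r : nat) (a : 'I_r -> arr_to x), bijective a ->
       right_almost_split (hrow (fun i => f _ _ (tagged (a i))))) /\
    (forall x : vert G, injective_module (rep x) ->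
       forall (r : nat) (a : 'I_r -> arr_from x), bijective a ->
       left_almost_split (hcol (fun i => f _ _ (tagged (a i))))) /\
    (forall (x : nonprojective G) (r : nat) (a : 'I_r -> arr_to (sval x)),
       bijective a ->
       almost_split_sequence
         (hcol (fun i => f _ _ (sigma (tagged (a i)))))
         (hrow (fun i => f _ _ (tagged (a i))))).
Proof.
split=> [[F [Fl Fr]]|[f [firr [fproj [finj fmesh]]]]].
  exists (fun x y a => F x y (arrow_class a)); split; [|split; [|split]].
  (* Irreducibility of an arrow is read off the row at its end [y], where a finite enumeration
     exists. *)
  - move=> x y al; have [r [a abij]] := arr_to_finite y.
    have [Fm Fras] := Fr y r a abij.
    suff irr (s : arr_to y) : irreducible_ind (F _ _ (arrow_class (tagged s))).
      exact: (irr (existT _ x al)).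
    case: abij => b ab ba; rewrite -(ba s); move: (b s) => {s al ab ba} i;
      split.
      rewrite -(hrow_dinj (fun i => F _ _ (arrow_class (tagged (a i)))) i).
      by have [/radicalE Frad _ _] := Fras; apply/radicalE/radmor_compr.
    apply: (rmas_row_not_rad2 (f := fun i => F _ _ (arrow_class (tagged (a
      i)))) _ Fras Fm).
    by move=> j; apply: rep_indec.
  - by move=> x _ r a abij; have [] := Fr x r a abij.
  - by move=> x _ r a abij; have [] := Fl x r a abij.
  move=> x r a abij; have [gm gr] := Fr _ r a abij.
  have [fm fl] := Fl _ r _ (bij_comp (sigma_from_bij x) abij).
  apply: (mas_almost_split_sequence fl fm gr gm).
  - exact: tau_noninjective.
  - exact: (svalP x).
  - exact: mesh_row_col.
have frad x y (a : arr x y) : radmor (f x y a) by apply/radicalE/(firr x y a).1.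
have [|F Ff] := @mesh_functor_exists _ _ G f.
  move=> x r a abij; have [[_ fg _] _ _] := fmesh x r a abij.
  rewrite -hrow_hcol; apply: homA_ext => u; apply/fg.
  by exists u.
exists F; split=> x r a abij /=.
  have -> : (fun i => F _ _ (arrow_class (tagged (a i)))) =
      (fun i => f _ _ (tagged (a i))).
    by apply/functional_extensionality_dep => i; apply: Ff.
  suff fl : left_almost_split (hcol (fun i => f _ _ (tagged (a i)))).
    split; last exact: fl.
    apply: (col_left_minimal (f := fun s => f _ _ (tagged s)) _ abij fl) => s.
    exact: frad.
  have [xinj|/tau_surj[z zx]] := EM (injective_module (rep x)); first exact:
    finj.
  (* A non-injective vertex is [tau z]; the given enumeration of the arrows starting there is pulled
     back along [sigma_from] to one of the arrows ending at [z], to which the mesh condition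
     applies. *)
  move: a abij; rewrite -zx => a abij.
  have [s' sK s'K] := sigma_from_bij z; pose b := s' \o a.
  have bbij : bijective b by apply: bij_comp => //; exists (@sigma_from _ _ _
    z).
  have -> : a = fun i => sigma_from (b i).
    by apply/functional_extensionality_dep => i; rewrite s'K.
  exact: (ass_left_almost_split (fmesh z r b bbij) (rep_indec _)).
have -> : (fun i => F _ _ (arrow_class (tagged (a i)))) =
    (fun i => f _ _ (tagged (a i))).
  by apply/functional_extensionality_dep => i; apply: Ff.
suff fr : right_almost_split (hrow (fun i => f _ _ (tagged (a i)))).
  split; last exact: fr.
  apply: (row_right_minimal (f := fun s => f _ _ (tagged s)) _ abij fr) => s.
  exact: frad.
have [xp|xnp] := EM (projective_module (rep x)); first exact: fproj.
exact: (ass_right_almost_split (fmesh (exist _ x xnp) r a abij) (rep_indec _)).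
Qed.
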